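(* Let $\xi_1,\dots,\xi_n$ be i.i.d. random variables with values in a measurable space $\mathcal{Z}$ and common distribution $P$. Let $\mathcal{S}$ be a set and let $\gamma:\mathcal{S}\times\mathcal{Z}\to[0,1]$ be a loss function (with $\gamma(t,\cdot)$ measurable for each $t\in\mathcal{S}$) such that $s\in\mathcal{S}$ minimizes $P[\gamma(t,\cdot)]$ when $t$ varies in $\mathcal{S}$. Put $$\ell(s,t)=P[\gamma(t,\cdot)-\gamma(s,\cdot)],\qquad \gamma_n(t)=\frac1n\sum_{i=1}^n\gamma(t,\xi_i),\qquad \overline{\gamma}_n(t)=\gamma_n(t)-P[\gamma(t,\cdot)]\qquad (t\in\mathcal{S}).$$ Let $d$ be a pseudo-distance on $\mathcal{S}\times\mathcal{S}$ such that $\operatorname{Var}_P[\gamma(t,\cdot)-\gamma(s,\cdot)]\le d^2(s,t)$ for every $t\in\mathcal{S}$. Let $\phi$ and $w$ belong to the class of functions $\mathcal{C}_1$, and let $S\subset\mathcal{S}$ satisfy the separability condition (M), with associated countable subset $S'\subset S$. Assume that, on the one hand, $$d(s,t)\le w\big(\sqrt{\ell(s,t)}\big)\qquad\text{for every } t\in\mathcal{S},$$ and that, on the other hand, for every $u\in S'$, $$\sqrt{n}\,\mathbb{E}\Big[\sup_{t\in S',\,d(u,t)\le\sigma}[\overline{\gamma}_n(u)-\overline{\gamma}_n(t)]\Big]\le\phi(\sigma)$$ for every positive $\sigma$ such that $\phi(\sigma)\le\sqrt{n}\,\sigma^2$. Let $\varepsilon_*$ be the unique positive solution of the equation $$\sqrt{n}\,\varepsilon_*^2=\phi(w(\varepsilon_*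 )).$$ Let $\rho\ge0$ and let $\hat s$ be a $\rho$-empirical risk minimizer on $S$. Then there exists an absolute constant $\kappa$ such that, for every $y\ge1$, $$\mathbb{P}\big[\ell(s,\hat s)>2\rho+2\ell(s,S)+\kappa y\varepsilon_*^2\big]\le e^{-y}.$$ In particular, the following risk bound holds: $$\mathbb{E}[\ell(s,\hat s)]\le2\big(\rho+\ell(s,S)+\kappa\varepsilon_*^2\big).$$
   Context: Notation: $P[f]=\int f\,dP$; $\ell(s,S)=\inf_{t\in S}\ell(s,t)$. Class $\mathcal{C}_1$: the class of nondecreasing and continuous functions $\psi:\mathbb{R}_+\to\mathbb{R}_+$ such that $x\mapsto\psi(x)/x$ is nonincreasing on $(0,+\infty)$ and $\psi(1)\ge1$. Condition (M) on $S$: there exists a countable subset $S'$ of $S$ such that, for every $t\in S$, there exists a sequence $(t_k)$ of elements of $S'$ such that, for every $\xi\in\mathcal{Z}$, $\gamma(t_k,\xi)\to\gamma(t,\xi)$ as $k\to\infty$. $\rho$-empirical risk minimizer on $S$: an estimator $\hat s$ (a measurable function of $\xi_1,\dots,\xi_n$) taking its values in $S$ such that $\gamma_n(\hat s)\le\rho+\inf_{t\in S}\gamma_n(t)$. ''Absolute constant'' means a numerical constant that does not depend on any of the other quantities in the statement. *)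

(* Defs.v *)
From HB Require Import structures.
From mathcomp Require Import all_boot all_order all_algebra.
From mathcomp Require Import all_classical all_reals all_analysis.
Set Implicit Arguments.
Unset Strict Implicit.
Unset Printing Implicit Defensive.
Import Order.TTheory GRing.Theory Num.Theory.
Import numFieldNormedType.Exports.
Local Open Scope classical_set_scope.
Local Open Scope ring_scope.

(* A function from R_+ to R_+ is represented by a function psi : R -> R of
   which only the restriction to [0, +oo[ matters. *)
Definition classC1 (R : realType) (psi : R -> R) : Prop :=
  [/\ forall x, 0 <= x -> 0 <= psi x,
      forall x y, 0 <= x -> x <= y -> psi x <= psi y,
      {within `[0, +oo[%classic, continuous psi},
      forall x y, 0 < x -> x <= y -> psi y / y <= psi x / x
    & 1 <= psi 1].

Definition pseudo_distance (R : realType) (X : Type) (d : X -> X -> R) : Prop :=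
  [/\ forall x y, 0 <= d x y,
      forall x, d x x = 0,
      forall x y, d x y = d y x
    & forall x y z, d x z <= d x y + d y z].

Definition mutually_independent (R : realType) (dO dZ : measure_display)
    (Omega : measurableType dO) (Z : measurableType dZ)
    (Pr : probability Omega R) (n : nat) (xi : 'I_n -> {RV Pr >-> Z}) : Prop :=
  forall (J : {set 'I_n}) (A : 'I_n -> set Z),
    (forall i, measurable (A i)) ->
    Pr (\bigcap_(i in [set` J]) xi i @^-1` A i) =
    (\prod_(i in J) Pr (xi i @^-1` A i))%E.

Definition iid (R : realType) (dO dZ : measure_display)
    (Omega : measurableType dO) (Z : measurableType dZ)
    (Pr : probability Omega R) (P : probability Z R)
    (n : nat) (xi : 'I_n -> {RV Pr >-> Z}) : Prop :=
  mutually_independent xi /\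
  forall i (A : set Z), measurable A -> distribution Pr (xi i) A = P A.

Definition sample (R : realType) (dO dZ : measure_display)
    (Omega : measurableType dO) (Z : measurableType dZ)
    (Pr : probability Omega R) (n : nat) (xi : 'I_n -> {RV Pr >-> Z})
    (omega : Omega) : n.-tuple Z := [tuple xi i omega | i < n].

Section Losses.
Context (R : realType) (dZ : measure_display) (Z : measurableType dZ)
  (P : probability Z R) (SS : Type) (gamma : SS -> Z -> R).

Definition risk (t : SS) : R := \int[P]_z gamma t z.

Definition ell (s t : SS) : R := \int[P]_z (gamma t z - gamma s z).

Definition ell_set (s : SS) (S : set SS) : R := inf [set ell s t | t in S].

Definition emp_risk (n : nat) (x : n.-tuple Z) (t : SS) : R :=
  n%:R^-1 * \sum_(i < n) gamma t (tnth x i).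

Definition centered_emp_risk (n : nat) (x : n.-tuple Z) (t : SS) : R :=
  emp_risk x t - risk t.

(* The countable subset S' witnessing the separability of S is a parameter. *)
Definition separability (S S' : set SS) : Prop :=
  [/\ countable S', S' `<=` S
    & forall t, S t -> exists u : nat -> SS,
        (forall k, S' (u k)) /\
        forall z, (fun k => gamma (u k) z) @ \oo --> gamma t z].

End Losses.

(* SS carries a sigma-algebra so that "measurable function of the sample" makes
   sense for an SS-valued function. *)
Definition empirical_risk_minimizer (R : realType)
    (dO dZ dS : measure_display) (Omega : measurableType dO)
    (Z : measurableType dZ) (SS : measurableType dS)
    (Pr : probability Omega R) (n : nat) (xi : 'I_n -> {RV Pr >-> Z})
    (gamma : SS -> Z -> R) (S : set SS) (rho : R) (shat : Omega -> SS) : Prop :=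
  [/\ exists2 h : n.-tuple Z -> SS,
        measurable_fun [set: n.-tuple Z] h & shat = h \o sample xi,
      forall omega, S (shat omega)
    & forall omega, emp_risk gamma (sample xi omega) (shat omega) <=
        rho + inf [set emp_risk gamma (sample xi omega) t | t in S]].

(* Main.v *)
Require Import Defs.
From HB Require Import structures.
From mathcomp Require Import all_boot all_order all_algebra.
From mathcomp Require Import all_classical all_reals all_analysis.
From mathcomp Require Import measurable_realfun ring lra.
Set Implicit Arguments.
Unset Strict Implicit.
Unset Printing Implicit Defensive.
Import Order.TTheory GRing.Theory Num.Theory.
Import numFieldNormedType.Exports.
Local Open Scope classical_set_scope.
Local Open Scope ring_scope.

(* With x^2 of order y eps^2 and u in S' almost minimizing l(s, .), it suffices
   to show that, outside an event of probability e^-y, the deviation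
   between u and every t in S' is at most (l(s, t) + x^2) / 2. The weighted
   process (deviation) / (l(s, t) + x^2) has mean of order eps / x by
   peeling, and it concentrates around its mean by a Talagrand inequality with
   nonoptimal constants.

   Talagrand's inequality follows from the entropy method. Rounding a finite class
   of functions maps the sample to a finite product space, where entropy is
   subadditive; following Bousquet, comparison of the maximum Z with its
   leave-one-out versions gives
     Ent(e^(l Z)) <= l^2 (8 n v E e^(l Z) + 16 b E (Z e^(l Z))),
   which Herbst's argument integrates to
     E e^(l Z) <= exp (2 l (E Z + 8 n v l)) for 32 b l <= 1.
   Rounding errors vanish in the limit, and the countable class is the
   increasing union of finite ones. *)

(** * Finite product spaces *)

(** Independence enters only through the law of the rounded sample, a product weight on a finite
    type. There tensorization, differentiation of the moment generating function and boundedness of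
    the maximum all concern finite sums. The comparison point is [u] in [S'] and not [s], because
    the modulus hypothesis is centred at points of [S'] only and [s] may lie outside [S]. Distances
    from [u] are recovered by the triangle inequality through [s], which is why [u] must be almost
    minimizing. The exponential bound carries twice the mean instead of being centred. This is
    harmless: with [x = c * eps], peeling bounds the mean of the weighted process by [32 / c],
    whereas the threshold stays at 1/2. That threshold also produces the factor 2 in front of [rho]
    and of the infimum. Scaling: the weighted functions are bounded by [2 / x ^+ 2] and have
    variance at most [4 n / c ^+ 2], so [lam] of order [c ^+ 2 / n] gives an exponent of order
    [- c ^+ 2]. Hence [c ^+ 2] is taken proportional to [y]. This requires [eps <= 1]; for [eps > 1]
    the risk bound exceeds 1, which no relative risk does. *)

Lemma weighted_sum_gt0 (R : realType) (I : finType) (q f : I -> R) :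
  (forall i, 0 <= q i) -> \sum_i q i = 1 -> (forall i, 0 < f i) ->
  0 < \sum_i q i * f i.
Proof.
move=> q0 q1 f0; have qf0 i : 0 <= q i * f i by rewrite mulr_ge0// ltW.
rewrite lt0r sumr_ge0// andbT; apply/eqP => /psumr_eq0P h.
have : \sum_i q i = 0.
  apply: big1 => i _; have /eqP := h (fun i _ => qf0 i) i isT.
  by rewrite mulf_eq0 [f i == 0]gt_eqF// orbF => /eqP.
by rewrite q1 => /eqP; rewrite oner_eq0.
Qed.

Section FiniteProduct.
Context (R : realType) (W : finType) (p : W -> R) (n : nat).
Hypotheses (p_ge0 : forall w, 0 <= p w) (p_sum1 : \sum_w p w = 1).

Local Notation Y := {ffun 'I_n -> W}.

Definition prod_weight (y : Y) : R := \prod_i p (y i).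

Definition prod_mean (f : Y -> R) : R := \sum_y prod_weight y * f y.

Definition upd (y : Y) (k : 'I_n) (w : W) : Y :=
  [ffun i => if i == k then w else y i].

Definition avg (k : 'I_n) (f : Y -> R) (y : Y) : R :=
  \sum_w p w * f (upd y k w).

Lemma prod_weight_ge0 y : 0 <= prod_weight y.
Proof. by apply: prodr_ge0 => i _; exact: p_ge0. Qed.

Lemma sum_prod_weight : \sum_y prod_weight y = 1.
Proof.
have := bigA_distr_bigA (fun (_ : 'I_n) (w : W) => p w).
move=> /= <-; rewrite big1// => i _; exact: p_sum1.
Qed.

Lemma prod_mean_le f g : (forall y, f y <= g y) -> prod_mean f <= prod_mean g.
Proof.
by move=> fg; apply: ler_sum => y _; rewrite ler_wpM2l// prod_weight_ge0.
Qed.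

Lemma eq_prod_mean f g : (forall y, f y = g y) -> prod_mean f = prod_mean g.
Proof. by move=> fg; apply: eq_bigr => y _; rewrite fg. Qed.

Lemma prod_meanD f g : prod_mean (fun y => f y + g y) = prod_mean f + prod_mean g.
Proof. by rewrite -big_split/=; apply: eq_bigr => y _; rewrite mulrDr. Qed.

Lemma prod_meanZ c f : prod_mean (fun y => c * f y) = c * prod_mean f.
Proof. by rewrite mulr_sumr; apply: eq_bigr => y _; rewrite mulrCA. Qed.

Lemma prod_mean_cst c : prod_mean (fun=> c) = c.
Proof. by rewrite /prod_mean -mulr_suml sum_prod_weight mul1r. Qed.

Lemma prod_meanB f g : prod_mean (fun y => f y - g y) = prod_mean f - prod_mean g.
Proof.
rewrite -mulN1r -prod_meanZ -prod_meanD.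
by apply: eq_prod_mean => y; rewrite mulN1r.
Qed.

Lemma prod_mean_sum I (r : seq I) (F : I -> Y -> R) :
  prod_mean (fun y => \sum_(i <- r) F i y) = \sum_(i <- r) prod_mean (F i).
Proof.
rewrite /prod_mean exchange_big/=; apply: eq_bigr => y _; by rewrite mulr_sumr.
Qed.

Lemma prod_mean_gt0 f : (forall y, 0 < f y) -> 0 < prod_mean f.
Proof.
by apply: weighted_sum_gt0; [exact: prod_weight_ge0 | exact: sum_prod_weight].
Qed.

Lemma upd_at y k w : upd y k w k = w.
Proof. by rewrite ffunE eqxx. Qed.

Lemma upd_off y k w i : i != k -> upd y k w i = y i.
Proof. by move=> ik; rewrite ffunE (negbTE ik). Qed.

Lemma upd_upd y k w w' : upd (upd y k w) k w' = upd y k w'.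
Proof. by apply/ffunP => i; rewrite !ffunE; case: eqP. Qed.

Lemma upd_id y k : upd y k (y k) = y.
Proof. by apply/ffunP => i; rewrite !ffunE; case: eqP => // ->. Qed.

(** Kept in product form because [p (y k)] may be 0, so a quotient of weights would make no
    sense. *)
Lemma prod_weight_upd y k w :
  prod_weight (upd y k w) * p (y k) = prod_weight y * p w.
Proof.
rewrite /prod_weight (bigD1 k)//= [X in _ = X * _](bigD1 k)//= upd_at.
rewrite (eq_bigr (fun i => p (y i))); last by move=> i ik; rewrite upd_off.
by ring.
Qed.

(* [(y, w) |-> (upd y k w, y k)] is an involution preserving the weight. *)
Lemma prod_mean_avg k f : prod_mean (avg k f) = prod_mean f.
Proof.
pose h (z : Y * W) := (upd z.1 k z.2, z.1 k).
have hK : cancel h h.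
  by move=> [y w]; rewrite /h /= upd_at upd_upd upd_id.
transitivity (\sum_(z : Y * W) prod_weight z.1 * p z.2 * f (h z).1).
  rewrite /prod_mean.
  rewrite -(pair_bigA _ (fun y w => prod_weight y * p w * f (h (y, w)).1))/=.
  by apply: eq_bigr => y _; rewrite mulr_sumr; apply: eq_bigr => w _; rewrite mulrA.
rewrite (reindex_inj (can_inj hK))/=.
rewrite (eq_bigr (fun z : Y * W => prod_weight z.1 * p z.2 * f z.1)); last first.
  by move=> [y w] _; rewrite prod_weight_upd /= upd_upd upd_id.
rewrite -(pair_bigA _ (fun y w => prod_weight y * p w * f y))/=.
apply: eq_bigr => y _.
by rewrite -mulr_suml -mulr_sumr p_sum1 mulr1.
Qed.

End FiniteProduct.

(** * Tensorization of entropy *)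

(** The tangent of [ln] at 1, evaluated at [b / a]. Summed over a finite law it becomes the Gibbs
    inequality. *)
Lemma ln_tangent (R : realType) (a b : R) : 0 < a -> 0 < b ->
  a * (ln b - ln a) <= b - a.
Proof.
move=> a0 b0; rewrite -ln_div ?posrE//.
have -> : b - a = a * (b / a - 1) by field; rewrite gt_eqF.
rewrite ler_wpM2l ?(ltW a0)//.
have := @le_ln1Dx R (b / a - 1).
rewrite (_ : 1 + (b / a - 1) = b / a); last by ring.
apply.
by rewrite ltrBrDl subrr divr_gt0.
Qed.

Section Entropy.
Context (R : realType) (W : finType) (p : W -> R) (n : nat).
Hypotheses (p_ge0 : forall w, 0 <= p w) (p_sum1 : \sum_w p w = 1).

Local Notation Y := {ffun 'I_n -> W}.
Local Notation avg := (avg p).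
Local Notation E := (prod_mean p).

Lemma avg_upd k (G : Y -> R) y w : avg k G (upd y k w) = avg k G y.
Proof. by apply: eq_bigr => w' _; rewrite upd_upd. Qed.

(* [G / avg k G] has mean 1 along coordinate [k], so the left-hand side is at
   most the entropy of [f] along [k] (Gibbs), which is the minimum of the
   right-hand side over all [u] not depending on coordinate [k]. *)
Lemma entropy_step (k : 'I_n) (f G u : Y -> R) :
  (forall y, 0 < f y) -> (forall y, 0 < G y) -> (forall y, 0 < u y) ->
  (forall y w, u (upd y k w) = u y) ->
  E (fun y => f y * (ln (G y) - ln (avg k G y)))
  <= E (fun y => f y * (ln (f y) - ln (u y)) - f y + u y).
Proof.
move=> f0 G0 u0 uk.
rewrite -(prod_mean_avg p_sum1 k) -[leRHS](prod_mean_avg p_sum1 k).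
apply: prod_mean_le => // y.
set c := avg k G y.
have c0 : 0 < c by apply: (@weighted_sum_gt0 _ _ p) => // w.
pose m := \sum_w p w * f (upd y k w).
have m0 : 0 < m by apply: (@weighted_sum_gt0 _ _ p) => // w.
have hL : avg k (fun y => f y * (ln (G y) - ln (avg k G y))) y =
  \sum_w p w * (f (upd y k w) * (ln (G (upd y k w)) - ln c)).
  by apply: eq_bigr => w _; rewrite avg_upd.
have hR : avg k (fun y => f y * (ln (f y) - ln (u y)) - f y + u y) y =
  \sum_w p w * (f (upd y k w) * (ln (f (upd y k w))))  - m * ln (u y) - m + u y.
  rewrite /avg (eq_bigr (fun w => p w * (f (upd y k w) * (ln (f (upd y k w)))) +
     p w * f (upd y k w) * (- ln (u y) - 1) + p w * u y)); last first.
    by move=> w _; rewrite uk; ring.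
  by rewrite !big_split/= -!mulr_suml p_sum1 -/m; ring.
rewrite hL hR.
have h1 w : f (upd y k w) * (ln (G (upd y k w)) + ln m - ln c - ln (f (upd y k w)))
    <= G (upd y k w) * (m / c) - f (upd y k w).
  have := ln_tangent (f0 (upd y k w)) (mulr_gt0 (G0 (upd y k w)) (divr_gt0 m0 c0)).
  by rewrite lnM ?ln_div ?posrE ?divr_gt0// addrA.
have : \sum_w p w * (f (upd y k w) * (ln (G (upd y k w)) + ln m - ln c - ln (f (upd y k w))))
   <= \sum_w p w * (G (upd y k w) * (m / c) - f (upd y k w)).
  by apply: ler_sum => w _; rewrite ler_wpM2l.
rewrite (eq_bigr (fun w => p w * (f (upd y k w) * (ln (G (upd y k w)) - ln c))
   - p w * (f (upd y k w) * ln (f (upd y k w))) + p w * f (upd y k w) * ln m)); last first.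
  by move=> w _; ring.
rewrite [leRHS](eq_bigr (fun w => p w * G (upd y k w) * (m / c) - p w * f (upd y k w))); last first.
  by move=> w _; ring.
rewrite !big_split/= !sumrN -!mulr_suml -/m -/(avg k G y) -/c.
have -> : c * (m / c) = m by field; rewrite gt_eqF.
have := ln_tangent m0 (u0 y).
by lra.
Qed.

(** Telescoping: averaging out the coordinates one after another turns [ln f - ln (E f)] into a sum
    of differences [ln (G r) - ln (avg k (G r))], each handled by [entropy_step]. The free choice of
    [u k] is what later admits the leave-one-out maxima. *)
Lemma entropy_tensorization (f : Y -> R) (u : 'I_n -> Y -> R) :
  (forall y, 0 < f y) -> (forall k y, 0 < u k y) ->
  (forall k y w, u k (upd y k w) = u k y) ->
  E (fun y => f y * ln (f y)) - E f * ln (E f)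
  <= \sum_k E (fun y => f y * (ln (f y) - ln (u k y)) - f y + u k y).
Proof.
move=> f0 u0 uk.
pose G (r : seq 'I_n) := foldr (fun k => avg k) f r.
have G0 r y : 0 < G r y.
  elim: r y => [|k r IH] y //=; apply: (@weighted_sum_gt0 _ _ p) => // w.
have GE r : E (G r) = E f.
  by elim: r => //= k r IH; rewrite (prod_mean_avg p_sum1).
have Gdep (r : seq 'I_n) (y y' : Y) : (forall i, i \notin r -> y i = y' i) -> G r y = G r y'.
  elim: r y y' => [|k r IH] y y' yy'.
    by congr f; apply/ffunP => i; exact: yy'.
  apply: eq_bigr => w _; congr (_ * _); apply: IH => i ir.
  rewrite !ffunE; case: eqP => // /eqP ik; apply: yy'.
  by rewrite inE negb_or ik.
have Gchain r : E (fun y => f y * ln (f y)) - E (fun y => f y * ln (G r y))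
    <= \sum_(k <- r) E (fun y => f y * (ln (f y) - ln (u k y)) - f y + u k y).
  elim: r => [|k r IH]; first by rewrite big_nil subrr.
  rewrite big_cons.
  have := entropy_step f0 (G0 r) (u0 k) (uk k).
  rewrite (@eq_prod_mean _ _ _ _ (fun y => f y * (ln (G r y) - ln (avg k (G r) y)))
     (fun y => f y * ln (G r y) - f y * ln (G (k :: r) y))); last by move=> y; rewrite mulrBr.
  rewrite prod_meanB.
  move: IH; lra.
(* Once every coordinate is averaged out, the function depends on none of them; a constant equals
   its own mean, and averaging has preserved the mean. *)
have Gall y : G (enum 'I_n) y = E f.
  rewrite -(GE (enum 'I_n)) -[LHS](prod_mean_cst n p_sum1).
  apply: eq_prod_mean => y'; apply: Gdep => i; by rewrite mem_enum.
have := Gchain (enum 'I_n).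
rewrite big_enum/=.
rewrite [X in _ - X <= _](_ : _ = E f * ln (E f)) //.
rewrite mulrC -prod_meanZ; apply: eq_prod_mean => y.
by rewrite Gall mulrC.
Qed.

End Entropy.

(** * Moment generating function of a maximum of sums *)

Lemma expR_le_inv1B (R : realType) (u : R) : u < 1 -> expR u <= (1 - u)^-1.
Proof.
move=> u1; rewrite -[u in leLHS]opprK expRN lef_pV2 ?posrE ?expR_gt0 ?subr_gt0//.
exact: expR_ge1Dx.
Qed.

(** From [expR u <= (1 - u)^-1] and the identity [(1 - u) * (1 + u + 2 u^2) = 1 + u^2 * (1 - 2 u)].
    No lower bound on [u] is required. *)
Lemma expR_le_quad (R : realType) (u : R) : u <= 2^-1 ->
  expR u <= 1 + u + 2 * u ^+ 2.
Proof.
move=> u2; have u1 : 0 < 1 - u by lra.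
apply: (le_trans (expR_le_inv1B _)); first by lra.
rewrite -[_^-1]mul1r ler_pdivrMr//.
have : 0 <= u ^+ 2 * (1 - 2 * u) by rewrite mulr_ge0 ?sqr_ge0//; lra.
nra.
Qed.

Lemma expR_le2 (R : realType) (u : R) : u <= 2^-1 -> expR u <= 2.
Proof.
move=> u2; apply: (le_trans (expR_le_inv1B _)); first by lra.
by rewrite -[leRHS]invrK lef_pV2 ?posrE ?invr_gt0//; lra.
Qed.

(* [D] is the increment of the maximum when one coordinate is added and [G] the
   increment of the former maximizer: [D^2 <= 2 G^2 + 4 b (D - G)], and [G] is
   centered, so that only the variance of [G] and the mean of [D] are left. *)
Lemma one_coordinate_entropy (R : realType) (W : finType) (p : W -> R)
    (c lam b v : R) (D G : W -> R) :
  (forall w, 0 <= p w) -> \sum_w p w = 1 ->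
  0 <= lam -> 0 < b -> lam * b <= 2^-1 ->
  (forall w, - b <= G w) -> (forall w, G w <= D w) -> (forall w, D w <= b) ->
  \sum_w p w * G w = 0 -> \sum_w p w * G w ^+ 2 <= v ->
  \sum_w p w * (expR (c + lam * D w) * (lam * D w)
                 - expR (c + lam * D w) + expR c)
  <= lam ^+ 2 * (8 * v * \sum_w p w * expR (c + lam * D w)
                 + 16 * b * \sum_w p w * (D w * expR (c + lam * D w))).
Proof.
move=> p0 p1 l0 b0 lb Gb GD Db EG EG2.
set C := expR c; have C0 : 0 < C by exact: expR_gt0.
have v0 : 0 <= v.
  by apply: le_trans EG2; apply: sumr_ge0 => w _; rewrite mulr_ge0// sqr_ge0.
have lD w : - 2^-1 <= lam * D w <= 2^-1.
  apply/andP; split.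
    have : lam * (- b) <= lam * D w by rewrite ler_wpM2l// (le_trans (Gb w)).
    lra.
  by apply: le_trans lb; rewrite ler_wpM2l.
have lD1 w := andP (lD w).
have XE w : expR (c + lam * D w) = C * expR (lam * D w) by rewrite expRD.
have pt w : expR (c + lam * D w) * (lam * D w) - expR (c + lam * D w) + C
    <= 4 * lam ^+ 2 * C * (2 * G w ^+ 2 + 4 * b * (D w - G w)).
  rewrite XE; set a := lam * D w.
  have [a1 a2] := lD1 w; rewrite -/a in a1 a2.
  have -> : C * expR a * a - C * expR a + C = C * expR a * (a - 1 + expR (- a)).
    by rewrite expRN; field; rewrite gt_eqF// expR_gt0.
  have e1 : a - 1 + expR (- a) <= 2 * a ^+ 2.
    have := @expR_le_quad R (- a); rewrite sqrrN => /(_ _)/wrap[]; first by lra.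
    lra.
  have e2 := expR_le2 a2.
  have e0 := expR_gt0 a.
  apply: (@le_trans _ _ (C * expR a * (2 * a ^+ 2))).
    by rewrite ler_wpM2l// mulr_ge0// ltW.
  apply: (@le_trans _ _ (C * 2 * (2 * a ^+ 2))).
    apply: ler_wpM2r; first by rewrite mulr_ge0 ?sqr_ge0.
    by rewrite ler_wpM2l// ltW.
  rewrite /a exprMn.
  have -> : C * 2 * (2 * (lam ^+ 2 * D w ^+ 2)) = 4 * lam ^+ 2 * C * D w ^+ 2 by ring.
  rewrite ler_wpM2l ?mulr_ge0 ?sqr_ge0 ?(ltW C0)//.
  have h1 : 0 <= D w - G w by rewrite subr_ge0.
  have h2 : D w - G w <= 2 * b by have := Gb w; have := Db w; lra.
  have h3 : (D w - G w) * (D w - G w) <= (D w - G w) * (2 * b) by rewrite ler_wpM2l.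
  (* This square is [2 G^2 + 2 (D - G)^2 - D^2], and [h3] replaces [(D - G)^2] by [2 b (D - G)]. *)
  have : 0 <= (D w - 2 * G w) ^+ 2 by exact: sqr_ge0.
  nra.
set ED := \sum_w p w * D w.
have ED0 : 0 <= ED by rewrite -EG; apply: ler_sum => w _; rewrite ler_wpM2l.
(* The pointwise bound carries the constant weight [C = expR c], the conclusion the weight
   [expR (c + lam * D w)]. The exchange rests on [0 <= ED] together with [1 + u <= expR u], and on
   [D * (expR (lam * D) - 1) >= 0]. *)
have h1 : C <= \sum_w p w * expR (c + lam * D w).
  apply: (@le_trans _ _ (\sum_w p w * (C * (1 + lam * D w)))).
    rewrite (eq_bigr (fun w => p w * C + p w * D w * (lam * C))); last by move=> w _; ring.
    rewrite big_split/= -!mulr_suml p1 mul1r lerDl -/ED.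
    by rewrite !mulr_ge0// ltW.
  apply: ler_sum => w _; rewrite ler_wpM2l// XE ler_wpM2l ?(ltW C0)//.
  exact: expR_ge1Dx.
have h2 : C * ED <= \sum_w p w * (D w * expR (c + lam * D w)).
  rewrite mulr_sumr; apply: ler_sum => w _; rewrite XE.
  have -> : C * (p w * D w) = p w * C * D w by ring.
  have -> : p w * (D w * (C * expR (lam * D w))) = p w * C * (D w * expR (lam * D w)) by ring.
  rewrite ler_wpM2l ?mulr_ge0 ?(ltW C0)//.
  have : 0 <= D w * (expR (lam * D w) - 1); last by lra.
  have [d0|d0] := leP 0 (D w).
    by rewrite mulr_ge0// subr_ge0 -expR0 ler_expR mulr_ge0.
  rewrite nmulr_rge0// subr_le0 expR_le1.
  by rewrite mulr_ge0_le0// ltW.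
apply: (@le_trans _ _ (\sum_w p w * (4 * lam ^+ 2 * C * (2 * G w ^+ 2 + 4 * b * (D w - G w))))).
  by apply: ler_sum => w _; rewrite ler_wpM2l.
rewrite (eq_bigr (fun w => p w * G w ^+ 2 * (8 * lam ^+ 2 * C) + p w * D w * (16 * b * lam ^+ 2 * C)
  - p w * G w * (16 * b * lam ^+ 2 * C))); last by move=> w _; ring.
rewrite !big_split/= sumrN -!mulr_suml EG mul0r subr0 -/ED mulrDr.
apply: lerD.
  apply: (@le_trans _ _ (v * (8 * lam ^+ 2 * C))).
    by rewrite ler_wpM2r// !mulr_ge0 ?sqr_ge0// ltW.
  have -> : v * (8 * lam ^+ 2 * C) = lam ^+ 2 * (8 * v) * C by ring.
  by rewrite [leRHS]mulrA ler_wpM2l// !mulr_ge0 ?sqr_ge0.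
have -> : ED * (16 * b * lam ^+ 2 * C) = lam ^+ 2 * (16 * b * (C * ED)) by ring.
by rewrite ler_wpM2l ?sqr_ge0// ler_wpM2l// mulr_ge0// ltW.
Qed.

(** The index ['I_N.+1] is nonempty, so the maximum is attained. The maximizer itself is needed, as
    the competitor in the leave-one-out comparisons. *)
Definition argmax_ord (R : realType) (N : nat) (F : 'I_N.+1 -> R) : 'I_N.+1 :=
  [arg max_(j > ord0) F j]%O.

Lemma argmax_ordP (R : realType) (N : nat) (F : 'I_N.+1 -> R) j :
  F j <= F (argmax_ord F).
Proof. by rewrite /argmax_ord; case: arg_maxP => // i _; apply. Qed.

Definition max_ord (R : realType) (N : nat) (F : 'I_N.+1 -> R) : R :=
  F (argmax_ord F).

Section EntropyMax.
Context (R : realType) (W : finType) (p : W -> R) (n N : nat).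
Context (g : 'I_N.+1 -> W -> R) (b v : R).
Hypotheses (p_ge0 : forall w, 0 <= p w) (p_sum1 : \sum_w p w = 1).
Hypotheses (b_gt0 : 0 < b) (g_bounded : forall j w, - b <= g j w <= b).
Hypotheses (g_centered : forall j, \sum_w p w * g j w = 0).
Hypotheses (g_var : forall j, \sum_w p w * g j w ^+ 2 <= v).

Local Notation Y := {ffun 'I_n -> W}.
Local Notation avg := (avg p).
Local Notation E := (prod_mean p).

Definition max_sum (y : Y) : R := max_ord (fun j => \sum_i g j (y i)).

Local Notation Z := max_sum.

(* Leaving out coordinate [k] decreases the maximum [Z] to [Zk], and
   [\sum_k (Z - Zk) <= Z] since the maximizer of [Z] competes in each [Zk]. *)
Lemma max_sum_entropy (lam : R) : 0 <= lam -> lam * b <= 2^-1 ->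
  E (fun y => expR (lam * Z y) * (lam * Z y))
    - E (fun y => expR (lam * Z y)) * ln (E (fun y => expR (lam * Z y)))
  <= lam ^+ 2 * (8 * (n%:R * v) * E (fun y => expR (lam * Z y))
                 + 16 * b * E (fun y => Z y * expR (lam * Z y))).
Proof.
move=> l0 lb.
pose Sk (k : 'I_n) (y : Y) j := \sum_(i | i != k) g j (y i).
pose jk k y := argmax_ord (Sk k y).
pose Zk k y := Sk k y (jk k y).
have Sk_upd k y w : Sk k (upd y k w) = Sk k y.
  by apply/funext => j; apply: eq_bigr => i ik; rewrite upd_off.
have Zk_upd k y w : Zk k (upd y k w) = Zk k y by rewrite /Zk /jk Sk_upd.
have Ssplit (k : 'I_n) (y : Y) j : \sum_i g j (y i) = Sk k y j + g j (y k).
  by rewrite (bigD1 k)//= addrC.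
have key k y : avg k (fun y => expR (lam * Z y) * (ln (expR (lam * Z y)) - ln (expR (lam * Zk k y)))
       - expR (lam * Z y) + expR (lam * Zk k y)) y <=
    avg k (fun y => lam ^+ 2 * (8 * v * expR (lam * Z y) +
              16 * b * ((Z y - Zk k y) * expR (lam * Z y)))) y.
  pose D w := Z (upd y k w) - Zk k y.
  have cD w : lam * Zk k y + lam * D w = lam * Z (upd y k w).
    by rewrite /D -mulrDr addrC subrK.
  have GD w : g (jk k y) w <= D w.
    rewrite /D lerBrDl.
    apply: le_trans (argmax_ordP (fun j => \sum_i g j (upd y k w i)) (jk k y)).
    by rewrite (Ssplit k) Sk_upd upd_at.
  have Db w : D w <= b.
    rewrite /D lerBlDl /max_sum /max_ord (Ssplit k) Sk_upd upd_at.
    by apply: lerD; [exact: argmax_ordP | case/andP: (g_bounded (argmax_ord (fun j => \sum_i g j (upd y k w i))) w)].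
  have gb w : - b <= g (jk k y) w by case/andP: (g_bounded (jk k y) w).
  have := @one_coordinate_entropy R W p (lam * Zk k y) lam b v D (g (jk k y))
     p_ge0 p_sum1 l0 b_gt0 lb gb GD Db (g_centered _) (g_var _).
  rewrite [X in X <= _ -> _](_ : _ = avg k (fun y => expR (lam * Z y) * (ln (expR (lam * Z y)) - ln (expR (lam * Zk k y)))
       - expR (lam * Z y) + expR (lam * Zk k y)) y); last first.
    apply: eq_bigr => w _; rewrite cD Zk_upd !expRK /D.
    by congr (_ * (_ * _ - _ + _)); rewrite mulrBr.
  move=> /le_trans; apply.
  rewrite (_ : \sum_w p w * expR (lam * Zk k y + lam * D w) =
    avg k (fun y => expR (lam * Z y)) y); last by apply: eq_bigr => w _; rewrite cD.
  rewrite (_ : \sum_w p w * (D w * expR (lam * Zk k y + lam * D w)) =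
    avg k (fun y => (Z y - Zk k y) * expR (lam * Z y)) y); last first.
    by apply: eq_bigr => w _; rewrite cD Zk_upd.
  rewrite le_eqVlt; apply/orP; left; apply/eqP.
  rewrite mulrDr !(mulrA (lam ^+ 2)) [X in X + _]mulr_sumr [X in _ + X]mulr_sumr -big_split.
  by apply: eq_bigr => w _ /=; ring.
have := @entropy_tensorization R W p n p_ge0 p_sum1 (fun y => expR (lam * Z y))
  (fun k y => expR (lam * Zk k y)).
move=> /(_ (fun=> expR_gt0 _))/(_ (fun _ _ => expR_gt0 _)).
have Zk_upd' k y w : expR (lam * Zk k (upd y k w)) = expR (lam * Zk k y) by rewrite Zk_upd.
move=> /(_ Zk_upd').
have -> : E (fun y => expR (lam * Z y) * ln (expR (lam * Z y))) =
   E (fun y => expR (lam * Z y) * (lam * Z y)) by apply: eq_prod_mean => y; rewrite expRK.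
move=> /le_trans; apply.
apply: (@le_trans _ _ (\sum_k E (fun y => lam ^+ 2 * (8 * v * expR (lam * Z y) +
              16 * b * ((Z y - Zk k y) * expR (lam * Z y)))))).
  apply: ler_sum => k _.
  rewrite -(prod_mean_avg p_sum1 k) -[leRHS](prod_mean_avg p_sum1 k).
  by apply: prod_mean_le => // y; exact: key.
rewrite -prod_mean_sum.
rewrite -prod_meanZ -prod_meanZ -prod_meanD -prod_meanZ.
apply: prod_mean_le => // y.
rewrite -mulr_sumr ler_wpM2l ?sqr_ge0// big_split/= lerD//.
  by rewrite sumr_const card_ord -mulr_natl le_eqVlt; apply/orP; left; apply/eqP; ring.
rewrite -mulr_sumr ler_wpM2l ?mulr_ge0 ?(ltW b_gt0)// -mulr_suml.
rewrite ler_wpM2r ?(ltW (expR_gt0 _))//.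
apply: (@le_trans _ _ (\sum_k g (argmax_ord (fun j => \sum_i g j (y i))) (y k))) => //.
apply: ler_sum => k _.
rewrite lerBlDl /max_sum /max_ord (Ssplit k) lerD2r; exact: argmax_ordP.
Qed.

End EntropyMax.

Lemma is_derive_bigsum (R : realType) (I : Type) (r : seq I) (h : I -> R -> R)
    (dh : I -> R) (x : R) :
  (forall i, is_derive x 1 (h i) (dh i)) ->
  is_derive x 1 (fun t => \sum_(i <- r) h i t) (\sum_(i <- r) dh i).
Proof.
move=> hd; elim: r => [|i r IH].
  rewrite big_nil (_ : (fun _ => _) = cst 0); first exact: is_derive_cst.
  by apply/funext => t; rewrite big_nil.
rewrite big_cons (_ : (fun _ => _) = h i + (fun t => \sum_(i <- r) h i t)).
  exact: is_deriveD.
by apply/funext => t; rewrite big_cons.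
Qed.

(** * Herbst argument *)

Section Herbst.
Context (R : realType) (W : finType) (p : W -> R) (n : nat).
Hypotheses (p_ge0 : forall w, 0 <= p w) (p_sum1 : \sum_w p w = 1).

Local Notation Y := {ffun 'I_n -> W}.
Local Notation E := (prod_mean p).

Context (Z : Y -> R).
Let F lam := E (fun y => expR (lam * Z y)).
Let F' lam := E (fun y => Z y * expR (lam * Z y)).

Let F_gt0 lam : 0 < F lam.
Proof. by apply: prod_mean_gt0 => // y; exact: expR_gt0. Qed.

Let is_derive_F (x : R) : is_derive x 1 F (F' x).
Proof.
rewrite /F /F' /prod_mean; apply: is_derive_bigsum => y.
have -> : (fun t : R => prod_weight p y * expR (t * Z y)) =
  (prod_weight p y) \*: (expR \o (fun t => Z y * t)).
  by apply/funext => t /=; rewrite mulrC (mulrC t) mulrC.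
have H : is_derive x 1 (fun t : R => Z y * t) (Z y).
  apply: is_derive_eq (is_deriveZ (Z y) (is_derive_id x 1)) _.
  by rewrite /GRing.scale/= mulr1.
have := is_deriveZ (prod_weight p y) (is_derive1_comp (is_derive_expR (Z y * x)) H).
move=> H1; apply: is_derive_eq H1 _.
by rewrite /GRing.scale/= (mulrC x) (mulrC (expR _)).
Qed.

(** Divided by [lam ^+ 2 * F lam], the entropy bound says that the derivative of [ln F / lam] is at
    most [A + B * (ln F)']. Integrating from 0 gives [ln F * (1 - lam * B) <= lam * (m + A * lam)],
    and [lam * B <= 1/2] costs the factor 2. *)
Lemma herbst (A B lam0 m : R) :
  0 <= A -> 0 <= B -> lam0 * B <= 2^-1 -> E Z <= m -> 0 <= m ->
  (forall lam : R, 0 < lam <= lam0 ->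
     E (fun y => expR (lam * Z y) * (lam * Z y)) - F lam * ln (F lam)
     <= lam ^+ 2 * (A * F lam + B * F' lam)) ->
  forall lam : R, 0 < lam <= lam0 -> F lam <= expR (2 * lam * (m + A * lam)).
Proof.
move=> A0 B0 lB EZm m0 ent lam /andP[l0 ll0].
(* [H] is nonincreasing by [ent] and tends to [E Z] at [0]. *)
pose L x := ln (F x).
pose H x := L x * x^-1 - A * x - B * L x.
pose dL x := (F x)^-1 * F' x.
pose dH x := (L x * (- x ^- 2) + x^-1 * dL x) - A - B * dL x.
have dLx (x : R) : is_derive x 1 L (dL x).
  exact: (is_derive1_comp (is_derive1_ln (F_gt0 x)) (is_derive_F x)).
have dHx (x : R) : 0 < x -> is_derive x 1 H (dH x).
  move=> x0; have xn0 : x != 0 by rewrite gt_eqF.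
  have h1 : is_derive x 1 (fun y : R => y^-1) (- x ^- 2).
    apply: is_derive_eq (@is_deriveV R id x 1 1 xn0 (is_derive_id x 1)) _.
    by rewrite /GRing.scale/= mulr1.
  have h2 := is_deriveM (dLx x) h1.
  have h3 := is_deriveZ A (is_derive_id x (1 : R)).
  have h4 := is_deriveZ B (dLx x).
  apply: is_derive_eq (is_deriveB (is_deriveB h2 h3) h4) _.
  by rewrite /dH /GRing.scale/= mulr1.
have dH0 (x : R) : 0 < x <= lam0 -> dH x <= 0.
  move=> /andP[x0 xl]; have := ent x; rewrite x0 xl => /(_ isT) h.
  have Fx := F_gt0 x.
  have -> : dH x = (x ^+ 2 * F x)^-1 * ((x * F' x - F x * L x) - x ^+ 2 * (A * F x + B * F' x)).
    by rewrite /dH /dL; field; rewrite !gt_eqF.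
  rewrite pmulr_rle0 ?invr_gt0 ?mulr_gt0 ?exprn_gt0//.
  rewrite subr_le0; apply: le_trans h; rewrite lerB//.
  rewrite -prod_meanZ le_eqVlt; apply/orP; left; apply/eqP; apply: eq_prod_mean => y.
  by ring.
have Hmono (mu : R) : 0 < mu -> mu <= lam -> H lam <= H mu.
  move=> mu0 mul.
  have dmu (x : R) : x \in `]mu, lam[ -> is_derive x 1 H (dH x).
    by rewrite in_itv/= => /andP[mx _]; apply: dHx; exact: lt_trans mx.
  have cont : {within `[mu, lam], continuous H}.
    apply: derivable_within_continuous => x; rewrite in_itv/= => /andP[mx _].
    by have [] := dHx x (lt_le_trans mu0 mx).
  have [c cl] := MVT_segment mul dmu cont.
  move: cl; rewrite in_itv/= => /andP[mc cl] e.
  rewrite -subr_le0 e mulr_le0_ge0 ?subr_ge0// dH0//.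
  by rewrite (lt_le_trans mu0 mc) (le_trans cl).
pose M := \sum_y `|Z y|.
have ZM y : `|Z y| <= M.
  by rewrite /M (bigD1 y)//= lerDl sumr_ge0.
have M0 : 0 <= M by exact: sumr_ge0.
(* A quantitative upper half of the limit at 0, the only half needed. The crude bound [M] on the
   finitely many values of [Z] affects only the error term, which vanishes with [mu]. *)
have Hlim (mu : R) : 0 < mu -> mu * M <= 2^-1 -> H mu <= m + mu * (2 * M ^+ 2 + B * M).
  move=> mu0 muM.
  have muZ y : `|mu * Z y| <= mu * M by rewrite normrM gtr0_norm// ler_wpM2l// ltW.
  have Fup : F mu <= 1 + (mu * E Z + 2 * mu ^+ 2 * M ^+ 2).
    apply: (@le_trans _ _ (E (fun y => 1 + (mu * Z y + 2 * mu ^+ 2 * M ^+ 2)))).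
      apply: prod_mean_le => // y.
      apply: (le_trans (expR_le_quad _)).
        by apply: le_trans muM; apply: le_trans (muZ y); exact: ler_norm.
      rewrite addrA lerD2l -mulrA ler_wpM2l// -exprMn.
      by rewrite -real_normK ?num_real// lerXn2r ?nnegrE// mulr_ge0// ltW.
    by rewrite !prod_meanD prod_meanZ !prod_mean_cst.
  have Lup : L mu <= mu * E Z + 2 * mu ^+ 2 * M ^+ 2.
    rewrite -ler_expR lnK ?posrE//.
    by apply: (le_trans Fup); exact: expR_ge1Dx.
  have Llo : - (mu * M) <= L mu.
    rewrite -ler_expR lnK ?posrE//.
    rewrite -[leLHS](prod_mean_cst n p_sum1); apply: prod_mean_le => // y.
    by rewrite ler_expR; have := muZ y; rewrite ler_norml => /andP[].
  have h1 : L mu * mu^-1 <= m + 2 * mu * M ^+ 2.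
    rewrite ler_pdivrMr//; apply: (le_trans Lup).
    rewrite [leRHS]mulrDl; apply: lerD; first by rewrite mulrC ler_wpM2r// ltW.
    by rewrite le_eqVlt; apply/orP; left; apply/eqP; ring.
  have h2 : B * - (mu * M) <= B * L mu by rewrite ler_wpM2l.
  have h3 : 0 <= A * mu by rewrite mulr_ge0// ltW.
  rewrite /H; lra.
have Hm : H lam <= m.
  apply/ler_addgt0Pr => e e0.
  pose C := 2 * M ^+ 2 + B * M.
  have C0 : 0 <= C by rewrite addr_ge0 ?mulr_ge0 ?sqr_ge0.
  pose mu := Num.min lam (Num.min (2 * (M + 1))^-1 (e / (C + 1))).
  have M1 : 0 < M + 1 by lra.
  have C1 : 0 < C + 1 by lra.
  have mu0 : 0 < mu by rewrite !lt_min l0 invr_gt0 mulr_gt0//= divr_gt0.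
  have mul : mu <= lam by rewrite ge_min lexx.
  have mu1 : mu <= (2 * (M + 1))^-1 by rewrite !ge_min lexx orbT.
  have mu2 : mu <= e / (C + 1) by rewrite !ge_min lexx !orbT.
  apply: (le_trans (Hmono _ mu0 mul)); apply: (le_trans (Hlim _ mu0 _)).
    apply: (@le_trans _ _ ((2 * (M + 1))^-1 * (M + 1))).
      by rewrite ler_pM// ?(ltW mu0)// lerDl.
    by rewrite invfM -mulrA mulVf ?mulr1// gt_eqF.
  rewrite lerD2l -/C; apply: (@le_trans _ _ (e / (C + 1) * (C + 1))).
    by rewrite ler_pM// ?(ltW mu0)// lerDl.
  by rewrite divfK// gt_eqF.
rewrite -[leLHS]lnK ?posrE// ler_expR -/(L lam).
(* Bounding [1 - lam * B] below by 1/2 is legitimate only against a nonnegative [L lam]; if [L lam]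
   is negative, the target exponent is nonnegative anyway. *)
have [Ln|Lp] := ltP (L lam) 0.
  apply: (le_trans (ltW Ln)); rewrite !mulr_ge0 ?addr_ge0 ?mulr_ge0//; exact: ltW.
have h1 : L lam * (1 - lam * B) <= lam * (m + A * lam).
  have -> : L lam * (1 - lam * B) = lam * (H lam + A * lam).
    by rewrite /H; field; rewrite gt_eqF.
  by rewrite ler_wpM2l ?lerD2r// ltW.
have h2 : lam * B <= 2^-1 by apply: le_trans lB; rewrite ler_wpM2r.
have h3 : L lam * 2^-1 <= L lam * (1 - lam * B) by rewrite ler_wpM2l//; lra.
lra.
Qed.

End Herbst.

(** Herbst's argument with [A = 8 n v] and [B = 16 b]; the condition on [lam] is [lam * B <= 1/2].
    That [m] is nonnegative follows from the maximum dominating one centred sum. *)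
Lemma max_sum_mgf (R : realType) (W : finType) (p : W -> R) (n N : nat)
    (g : 'I_N.+1 -> W -> R) (b v m lam : R) :
  (forall w, 0 <= p w) -> \sum_w p w = 1 ->
  0 < b -> (forall j w, - b <= g j w <= b) ->
  (forall j, \sum_w p w * g j w = 0) ->
  (forall j, \sum_w p w * g j w ^+ 2 <= v) ->
  prod_mean p (@max_sum R W n N g) <= m -> 0 < lam -> lam * (32 * b) <= 1 ->
  prod_mean p (fun y : {ffun 'I_n -> W} => expR (lam * max_sum g y))
  <= expR (2 * lam * (m + 8 * (n%:R * v) * lam)).
Proof.
move=> p0 p1 b0 gb g0 gv EZm l0 lb.
have v0 : 0 <= v.
  by apply: le_trans (gv ord0); apply: sumr_ge0 => w _; rewrite mulr_ge0// sqr_ge0.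
have EZ0 : 0 <= prod_mean p (@max_sum R W n N g).
  apply: (@le_trans _ _ (prod_mean p (fun y : {ffun 'I_n -> W} => \sum_i g ord0 (y i)))).
    rewrite prod_mean_sum big1// => i _.
    rewrite -(prod_mean_avg p1 i) -[RHS](prod_mean_cst n p1).
    apply: eq_prod_mean => y; rewrite -(g0 ord0); apply: eq_bigr => w _.
    by rewrite upd_at.
  by apply: prod_mean_le => // y; exact: (argmax_ordP (fun j => \sum_i g j (y i))).
apply: (@herbst R W p n p0 p1 (@max_sum R W n N g) _ (16 * b) lam) => //.
- by rewrite !mulr_ge0.
- by rewrite mulr_ge0// ltW.
- by lra.
- exact: le_trans EZm.
- move=> mu /andP[mu0 mul]; apply: max_sum_entropy => //; first exact: ltW.
  have : mu * b <= lam * b by rewrite ler_wpM2r// ltW.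
  lra.
- by rewrite l0 lexx.
Qed.

(** * Concentration of the maximum of an empirical process *)

Section BoundedMeasurable.
Context d (T : measurableType d) (R : realType).
Implicit Types (f g : T -> R).

Lemma measurable_gt (f : T -> R) (a : R) :
  measurable_fun [set: T] f -> measurable [set x | f x > a].
Proof.
move=> mf; rewrite -[X in measurable X]setTI.
rewrite (_ : [set x | f x > a] = f @^-1` `]a, +oo[%classic); first exact: mf.
by apply/seteqP; split => x /=; rewrite in_itv/= andbT.
Qed.

(** Stable under all the operations used below and integrable for every probability, so linearity
    and monotonicity of means need no separate integrability argument. *)
Definition bdmeas f :=
  measurable_fun [set: T] f /\ exists M, forall x, `|f x| <= M.

Lemma bdmeas_cst c : bdmeas (fun=> c).
Proof. by split; [exact: measurable_cst | exists `|c|]. Qed.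

Lemma bdmeasD f g : bdmeas f -> bdmeas g -> bdmeas (fun x => f x + g x).
Proof.
move=> [mf [M fM]] [mg [N gN]]; split; first exact: measurable_funD.
by exists (M + N) => x; rewrite (le_trans (ler_normD _ _))// lerD.
Qed.

Lemma bdmeasM f g : bdmeas f -> bdmeas g -> bdmeas (fun x => f x * g x).
Proof.
move=> [mf [M fM]] [mg [N gN]]; split; first exact: measurable_funM.
by exists (M * N) => x; rewrite normrM ler_pM.
Qed.

Lemma bdmeasZ c f : bdmeas f -> bdmeas (fun x => c * f x).
Proof. by move=> mf; exact: (bdmeasM (bdmeas_cst c) mf). Qed.

Lemma bdmeasB f g : bdmeas f -> bdmeas g -> bdmeas (fun x => f x - g x).
Proof.
move=> mf mg; have := bdmeasD mf (bdmeasZ (-1) mg).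
by congr bdmeas; apply/funext => x; rewrite mulN1r.
Qed.

Lemma bdmeasX f n : bdmeas f -> bdmeas (fun x => f x ^+ n).
Proof.
move=> mf; elim: n => [|n IH]; first by have := bdmeas_cst 1.
have := bdmeasM mf IH.
by congr bdmeas; apply/funext => x; rewrite exprS.
Qed.

Lemma bdmeas_sum I (r : seq I) (F : I -> T -> R) :
  (forall i, bdmeas (F i)) -> bdmeas (fun x => \sum_(i <- r) F i x).
Proof.
move=> mF; elim: r => [|i r IH].
  have := bdmeas_cst 0; congr bdmeas; apply/funext => x; by rewrite big_nil.
have := bdmeasD (mF i) IH.
by congr bdmeas; apply/funext => x; rewrite big_cons.
Qed.

Lemma bdmeas_indic (A : set T) : measurable A -> bdmeas (\1_A).
Proof.
move=> mA; split; first exact: measurable_indic.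
by exists 1 => x; rewrite indicE normr_nat lern1 leq_b1.
Qed.

Lemma finite_indicE (F : finType) (X : T -> F) (G : F -> R) x :
  G (X x) = \sum_a G a * \1_(X @^-1` [set a]) x.
Proof.
rewrite (bigD1 (X x))//= big1 ?addr0; first by rewrite indicE mem_set// mulr1.
by move=> a aX; rewrite indicE memNset ?mulr0//= => /esym/eqP; rewrite (negbTE aX).
Qed.

Lemma bdmeas_finite (F : finType) (X : T -> F) (G : F -> R) :
  (forall a, measurable (X @^-1` [set a])) -> bdmeas (fun x => G (X x)).
Proof.
move=> mX; rewrite (funext (finite_indicE X G)).
by apply: bdmeas_sum => a; apply: bdmeasZ; exact: bdmeas_indic.
Qed.

Lemma bdmeas_comp d' (T' : measurableType d') (h : T' -> T) f :
  measurable_fun [set: T'] h -> bdmeas f ->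
  measurable_fun [set: T'] (f \o h) /\ exists M, forall x, `|f (h x)| <= M.
Proof.
by move=> mh [mf [M fM]]; split; [exact: measurableT_comp | exists M => x].
Qed.

Lemma bdmeas_sups (F : nat -> T -> R) (M : R) :
  (forall k, measurable_fun [set: T] (F k)) -> (forall k x, `|F k x| <= M) ->
  bdmeas (fun x => sup (range (F ^~ x))).
Proof.
move=> mF FM.
have ub x : has_ubound (range (F ^~ x)).
  by exists M => _ [k _ <-]; rewrite (le_trans (ler_norm _)).
split.
  have := @measurable_fun_sups _ _ _ [set: T] F 0 (fun t _ => ub t) mF.
  congr measurable_fun; apply/funext => x; rewrite /sups; congr sup.
  by apply/seteqP; split => [_ [k _ <-]|_ [k _ <-]]; exists k.
exists M => x; rewrite ler_norml; apply/andP; split.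
  apply: (@le_trans _ _ (F 0 x)); first by have := FM 0 x; rewrite ler_norml => /andP[].
  by apply: ub_le_sup => //; exists 0.
apply: ge_sup; first by exists (F 0 x), 0.
by move=> _ [k _ <-]; rewrite (le_trans (ler_norm _)).
Qed.

Context (P : probability T R).

Lemma bdmeas_integrable f : bdmeas f -> P.-integrable [set: T] (EFin \o f).
Proof.
move=> [mf [M fM]]; apply: measurable_bounded_integrable => //.
  by rewrite (le_lt_trans (probability_le1 P _))// ltry.
exists M; split; first exact: num_real.
by move=> x Mx y _ /=; rewrite (le_trans (fM y))// ltW.
Qed.

Lemma bdmeas_mean f : bdmeas f -> ('E_P[f] = (\int[P]_x f x)%:E)%E.
Proof.
move=> bf; rewrite unlock /Rintegral fineK//.
by apply: integrable_fin_num => //; exact: bdmeas_integrable.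
Qed.

Lemma mean_le f g : bdmeas f -> bdmeas g -> (forall x, f x <= g x) ->
  \int[P]_x f x <= \int[P]_x g x.
Proof. by move=> mf mg fg; apply: le_Rintegral => //; exact: bdmeas_integrable. Qed.

Lemma meanD f g : bdmeas f -> bdmeas g ->
  \int[P]_x (f x + g x) = \int[P]_x f x + \int[P]_x g x.
Proof. by move=> mf mg; apply: RintegralD => //; exact: bdmeas_integrable. Qed.

Lemma meanB f g : bdmeas f -> bdmeas g ->
  \int[P]_x (f x - g x) = \int[P]_x f x - \int[P]_x g x.
Proof. by move=> mf mg; apply: RintegralB => //; exact: bdmeas_integrable. Qed.

Lemma meanZ c f : bdmeas f -> \int[P]_x (c * f x) = c * \int[P]_x f x.
Proof. by move=> mf; apply: RintegralZl => //; exact: bdmeas_integrable. Qed.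

Lemma mean_cst c : \int[P]_(x in [set: T]) c = c.
Proof. by rewrite Rintegral_cst//= probability_setT mulr1. Qed.

Lemma mean_sum I (r : seq I) (F : I -> T -> R) : (forall i, bdmeas (F i)) ->
  \int[P]_x (\sum_(i <- r) F i x) = \sum_(i <- r) \int[P]_x F i x.
Proof.
move=> mF; elim: r => [|i r IH].
  by under eq_Rintegral do rewrite big_nil; rewrite big_nil mean_cst.
under eq_Rintegral do rewrite big_cons.
by rewrite big_cons -IH meanD//; exact: bdmeas_sum.
Qed.

Lemma mean_indic (A : set T) : measurable A -> \int[P]_x \1_A x = fine (P A).
Proof. by move=> mA; rewrite /Rintegral integral_indic// setIT. Qed.

Lemma mean_finite_law (F : finType) (X : T -> F) (G : F -> R) :
  (forall a, measurable (X @^-1` [set a])) ->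
  \int[P]_x G (X x) = \sum_a fine (P (X @^-1` [set a])) * G a.
Proof.
move=> mX; under eq_Rintegral do rewrite finite_indicE.
rewrite mean_sum; last by move=> a; apply: bdmeasZ; exact: bdmeas_indic.
apply: eq_bigr => a _; rewrite meanZ; last exact: bdmeas_indic.
by rewrite mean_indic// mulrC.
Qed.

(** Markov's inequality, later applied to an exponential. *)
Lemma prob_gt_le_mean (G : T -> R) (A : set T) (c : R) :
  measurable A -> 0 < c -> bdmeas G -> (forall x, 0 <= G x) ->
  (forall x, A x -> c <= G x) ->
  fine (P A) <= c^-1 * \int[P]_x G x.
Proof.
move=> mA c0 bG G0 AG; rewrite -mean_indic// -meanZ//.
apply: mean_le; [exact: bdmeas_indic | exact: bdmeasZ|] => x.
rewrite indicE; have [xA|xA] := boolP (x \in A).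
  by rewrite ler_pdivlMl// mulr1; apply: AG; exact: set_mem.
by rewrite mulr_ge0// invr_ge0 ltW.
Qed.

End BoundedMeasurable.

(** * Rounding the sample to a finite product space *)

Lemma max_ord_dist (R : realType) (N : nat) (F G : 'I_N.+1 -> R) (e : R) :
  (forall j, F j <= G j + e) -> max_ord F <= max_ord G + e.
Proof.
move=> FG; apply: (le_trans (FG _)); rewrite lerD2r.
exact: argmax_ordP.
Qed.

(** A single map [c] has to serve all the functions at once, so a point of [W] records, for each
    [j], the number of the cell of width [delta] in [[-b, b]] that contains [f j z]; [a j] returns
    the left end of that cell. Fibres of [c] are finite intersections of preimages of half-open
    intervals. *)
Lemma finite_discretization (R : realType) (dZ : measure_display)
    (Z : measurableType dZ) (N : nat) (f : 'I_N.+1 -> Z -> R) (b delta : R) :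
  (forall j, measurable_fun [set: Z] (f j)) -> (forall j z, `|f j z| <= b) ->
  0 < delta ->
  exists (W : finType) (c : Z -> W) (a : 'I_N.+1 -> W -> R),
    [/\ forall w, measurable (c @^-1` [set w]),
        forall j z, `|a j (c z) - f j z| <= delta
      & forall j w, `|a j w| <= b + delta].
Proof.
move=> mf fb d0.
have b0 : 0 <= b by apply: le_trans (fb ord0 point).
pose M := Num.truncn (2 * b / delta).
pose k j z := Num.truncn ((f j z + b) / delta).
have fb' j z : 0 <= f j z + b <= 2 * b.
  by have := fb j z; rewrite ler_norml => /andP[? ?]; apply/andP; split; lra.
have k0 j z : 0 <= (f j z + b) / delta.
  by have /andP[? _] := fb' j z; rewrite divr_ge0// ltW.
have kM j z : (k j z < M.+1)%N.
  rewrite ltnS truncn_ge_nat ?divr_ge0 ?mulr_ge0 ?(ltW d0)//.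
  apply: (@le_trans _ _ ((f j z + b) / delta)); first by rewrite truncn_le.
  by have /andP[_ ?] := fb' j z; rewrite ler_pM2r// invr_gt0.
have kitv j z (i : nat) : (k j z = i) <-> (f j z \in `[i%:R * delta - b, i.+1%:R * delta - b[).
  have := truncn_itv (k0 j z); rewrite -/(k j z) => kz.
  rewrite in_itv/= lerBlDr ltrBrDr -ler_pdivlMr// -ltr_pdivrMr//.
  split=> [<-//|]; exact: truncn_def.
exists {ffun 'I_N.+1 -> 'I_M.+1}, (fun z => [ffun j => Ordinal (kM j z)]),
  (fun j (w : {ffun 'I_N.+1 -> 'I_M.+1}) => (nat_of_ord (w j))%:R * delta - b).
split => [w|j z|j w].
- rewrite (_ : _ @^-1` _ = \bigcap_(j in [set: 'I_N.+1])
     (f j @^-1` `[(nat_of_ord (w j))%:R * delta - b, (nat_of_ord (w j)).+1%:R * delta - b[%classic)).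
    apply: fin_bigcap_measurable => // j _.
    by rewrite -[X in measurable X]setTI; apply: mf.
  apply/seteqP; split => z /=.
    by move=> <- j _ /=; rewrite ffunE/=; apply/kitv.
  move=> h; apply/ffunP => j; rewrite ffunE; apply/val_inj => /=.
  by apply/kitv; exact: h.
- rewrite ffunE /=; have := (kitv j z (k j z)).1 erefl.
  rewrite in_itv/= -natr1 mulrDl mul1r => /andP[h1 h2].
  by rewrite ler_norml; apply/andP; split; lra.
- have h1 : (nat_of_ord (w j))%:R * delta <= 2 * b.
    rewrite -ler_pdivlMr//; apply: (@le_trans _ _ M%:R).
      by rewrite ler_nat -ltnS.
    by rewrite truncn_le divr_ge0 ?mulr_ge0// ltW.
  have h2 : 0 <= (nat_of_ord (w j))%:R * delta by rewrite mulr_ge0// ltW.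
  by rewrite ler_norml; apply/andP; split; lra.
Qed.

Section SampleLaw.
Context (R : realType) (dO dZ : measure_display)
    (Omega : measurableType dO) (Z : measurableType dZ)
    (Pr : probability Omega R) (P : probability Z R)
    (n : nat) (xi : 'I_n -> {RV Pr >-> Z}).
Hypothesis xi_iid : iid P xi.

Lemma measurable_xi i (A : set Z) : measurable A -> measurable (xi i @^-1` A).
Proof.
by move=> mA; rewrite -[X in measurable X]setTI; exact: measurable_funP.
Qed.

Lemma bdmeas_xi i (f : Z -> R) : bdmeas f -> bdmeas (fun om => f (xi i om)).
Proof. by move=> mf; exact: (bdmeas_comp (measurable_funP (xi i)) mf). Qed.

Section Discrete.
Context (W : finType) (c : Z -> W).
Hypothesis mc : forall w, measurable (c @^-1` [set w]).

Let p w := fine (P (c @^-1` [set w])).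

Definition discrete_sample (om : Omega) : {ffun 'I_n -> W} :=
  [ffun i => c (xi i om)].

Let discrete_sampleE y : discrete_sample @^-1` [set y] =
  \bigcap_(i in [set` [set: 'I_n]%SET]) (xi i @^-1` (c @^-1` [set y i])).
Proof.
apply/seteqP; split => om /=.
  by move=> <- i _ /=; rewrite ffunE.
by move=> h; apply/ffunP => i; rewrite ffunE; apply: h => /=; rewrite inE.
Qed.

Lemma measurable_discrete_sample y :
  measurable (discrete_sample @^-1` [set y]).
Proof.
rewrite discrete_sampleE; apply: fin_bigcap_measurable => // i _.
exact: measurable_xi.
Qed.

(** Independence is applied with the full index set, equality of the laws to each factor. This is
    where both parts of [iid] are consumed. *)
Lemma discrete_sample_law y :
  fine (Pr (discrete_sample @^-1` [set y])) = prod_weight p y.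
Proof.
have [ind law] := xi_iid.
rewrite discrete_sampleE (ind _ (fun i => c @^-1` [set y i]))//.
rewrite (eq_bigr (fun i => (p (y i))%:E)); last first.
  move=> i _; rewrite /p fineK ?fin_num_measure//.
  by rewrite -(law i).
rewrite prodEFin/=; apply: eq_bigl => i; by rewrite inE.
Qed.

Lemma mean_discrete_sample (G : {ffun 'I_n -> W} -> R) :
  \int[Pr]_om G (discrete_sample om) = prod_mean p G.
Proof.
rewrite mean_finite_law; last exact: measurable_discrete_sample.
by apply: eq_bigr => y _; rewrite discrete_sample_law.
Qed.

End Discrete.
End SampleLaw.

Lemma bdmeas_max_ord (d : measure_display) (T : measurableType d) (R : realType)
    (N : nat) (F : 'I_N.+1 -> T -> R) :
  (forall j, bdmeas (F j)) -> bdmeas (fun x => max_ord (F ^~ x)).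
Proof.
move=> mF.
have [M FM] : exists M, forall j x, `|F j x| <= M.
  have /choice[M hM] : forall j, exists M, forall x, `|F j x| <= M.
    by move=> j; have [_] := mF j.
  exists (\sum_j `|M j|) => j x; apply: (le_trans (hM j x)).
  by rewrite (bigD1 j)//= (le_trans (ler_norm _))// lerDl sumr_ge0.
(* [inord k] is [ord0] for [k > N], so this sequence lists the values of [F] with repetitions and
   has the same supremum. *)
have := @bdmeas_sups _ _ _ (fun k => F (inord k)) M (fun k => (mF (inord k)).1) (fun k => FM _).
congr bdmeas; apply/funext => x; apply/eqP; rewrite eq_le; apply/andP; split.
  apply: ge_sup; first by exists (F (inord 0) x), 0%N.
  by move=> _ [k _ <-]; exact: (argmax_ordP (F ^~ x)).
apply: ub_le_sup.
  by exists M => _ [k _ <-]; rewrite (le_trans (ler_norm _)).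
by exists (argmax_ord (F ^~ x)) => //; rewrite inord_val.
Qed.

Section Concentration.
Context (R : realType) (dO dZ : measure_display)
    (Omega : measurableType dO) (Z : measurableType dZ)
    (Pr : probability Omega R) (P : probability Z R)
    (n : nat) (xi : 'I_n -> {RV Pr >-> Z}).
Hypothesis xi_iid : iid P xi.
Context (N : nat) (f : 'I_N.+1 -> Z -> R) (b v m lam a : R).
Hypotheses (mf : forall j, measurable_fun [set: Z] (f j)).
Hypotheses (fb : forall j z, `|f j z| <= b) (b_gt0 : 0 < b).
Hypotheses (f_centered : forall j, \int[P]_z f j z = 0).
Hypotheses (f_var : forall j, \int[P]_z (f j z ^+ 2) <= v).

Definition max_empirical (om : Omega) : R :=
  max_ord (fun j => \sum_i f j (xi i om)).

Hypothesis max_mean : \int[Pr]_om max_empirical om <= m.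
Hypotheses (lam_gt0 : 0 < lam) (lam_small : lam * (64 * b) <= 1).

Lemma bdmeas_max_empirical : bdmeas max_empirical.
Proof.
apply: bdmeas_max_ord => j; apply: bdmeas_sum => i.
apply: (@bdmeas_xi _ _ _ _ _ _ _ xi i (f j)).
by split => //; exists b.
Qed.

Let bound (delta : R) : R := 2 * n%:R * delta.

(** Rounding costs [delta] per value and destroys centring; subtracting the mean [mu j] costs
    [delta] again. Hence sums move by at most [2 n delta], the range grows to [2 b] (so [64 b] in
    place of [32 b]), and the variance to [2 v + 8 delta^2]. The rest is Chernoff's bound on the
    finite space. *)
Let discretized_tail (delta : R) : 0 < delta -> delta <= b / 2 ->
  fine (Pr [set om | max_empirical om > a])
  <= expR (- (lam * (a - bound delta))
       + 2 * lam * (m + bound delta + 8 * (n%:R * (2 * v + 8 * delta ^+ 2)) * lam)).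
Proof.
move=> d0 db.
have [W [c [q [mc qf qb]]]] := finite_discretization mf fb d0.
pose p w := fine (P (c @^-1` [set w])).
have p0 w : 0 <= p w by rewrite fine_ge0.
have sum_p G : \sum_w p w * G w = \int[P]_z G (c z).
  by rewrite mean_finite_law.
have p1 : \sum_w p w = 1.
  rewrite -[RHS](mean_cst P) -(sum_p (fun=> 1)).
  by apply: eq_bigr => w _; rewrite mulr1.
have bf j : bdmeas (f j) by split => //; exists b.
pose mu j := \sum_w p w * q j w.
have muE j : mu j = \int[P]_z (q j (c z) - f j z).
  rewrite meanB//; last exact: bdmeas_finite.
  by rewrite f_centered subr0 -sum_p.
have bq j : bdmeas (fun z => q j (c z)) by exact: bdmeas_finite.
have mu_small j : `|mu j| <= delta.
  have bqf : bdmeas (fun z => q j (c z) - f j z) by exact: bdmeasB.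
  rewrite muE ler_norml; apply/andP; split.
    rewrite -[leLHS](mean_cst P); apply: mean_le => //; first exact: bdmeas_cst.
    by move=> z; have := qf j z; rewrite ler_norml => /andP[].
  rewrite -[leRHS](mean_cst P); apply: mean_le => //; first exact: bdmeas_cst.
  by move=> z; have := qf j z; rewrite ler_norml => /andP[].
pose g j w := q j w - mu j.
have gf j z : `|g j (c z) - f j z| <= 2 * delta.
  rewrite /g addrAC (le_trans (ler_normB _ _))// mulrDl mul1r lerD//.
have gb j w : - (2 * b) <= g j w <= 2 * b.
  rewrite -ler_norml /g (le_trans (ler_normB _ _))//.
  have := qb j w; have := mu_small j; lra.
have g0 j : \sum_w p w * g j w = 0.
  rewrite (eq_bigr (fun w => p w * q j w - p w * mu j)); last by move=> w _; rewrite mulrBr.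
  by rewrite sumrB -mulr_suml p1 mul1r subrr.
have gv j : \sum_w p w * g j w ^+ 2 <= 2 * v + 8 * delta ^+ 2.
  rewrite (sum_p (fun w => g j w ^+ 2)).
  apply: (@le_trans _ _ (\int[P]_z (2 * f j z ^+ 2 + 8 * delta ^+ 2))).
    apply: mean_le.
    - exact: (@bdmeas_finite _ _ _ W c (fun w => g j w ^+ 2)).
    - by apply: bdmeasD; [apply: bdmeasZ; exact: bdmeasX | exact: bdmeas_cst].
    move=> z; have := gf j z; rewrite ler_norml => /andP[h1 h2].
    set x := g j (c z) in h1 h2 *; set y := f j z in h1 h2 *.
    have h3 : (x - y) ^+ 2 <= (2 * delta) ^+ 2.
      by rewrite -real_normK ?num_real// lerXn2r ?nnegrE ?mulr_ge0 ?(ltW d0)// ler_norml h1.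
    have : 0 <= (x - 2 * y) ^+ 2 by exact: sqr_ge0.
    nra.
  rewrite meanD ?mean_cst; last 2 first.
  - by apply: bdmeasZ; exact: bdmeasX.
  - exact: bdmeas_cst.
  rewrite lerD2r meanZ; last exact: bdmeasX.
  by rewrite ler_wpM2l.
have sum_close j om : `|\sum_i g j (c (xi i om)) - \sum_i f j (xi i om)| <= bound delta.
  rewrite -sumrB (le_trans (ler_norm_sum _ _ _))//.
  apply: (@le_trans _ _ (\sum_(i < n) 2 * delta)); first exact: ler_sum.
  by rewrite sumr_const card_ord -[_ *+ n]mulr_natl /bound mulrCA mulrA.
pose Y := discrete_sample xi c.
have YE om j : \sum_i g j (Y om i) = \sum_i g j (c (xi i om)).
  by apply: eq_bigr => i _; rewrite ffunE.
have up om : max_sum g (Y om) <= max_empirical om + bound delta.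
  apply: max_ord_dist => j; rewrite YE.
  by have := sum_close j om; rewrite ler_norml => /andP[]; lra.
have lo om : max_empirical om <= max_sum g (Y om) + bound delta.
  apply: max_ord_dist => j; rewrite YE.
  by have := sum_close j om; rewrite ler_norml => /andP[]; lra.
have bYG (G : {ffun 'I_n -> W} -> R) : bdmeas (fun om => G (Y om)).
  by apply: (@bdmeas_finite _ _ _ _ Y G) => y; exact: measurable_discrete_sample.
have EZ : prod_mean p (@max_sum R W n N g) <= m + bound delta.
  rewrite -(mean_discrete_sample xi_iid mc).
  apply: (@le_trans _ _ (\int[Pr]_om (max_empirical om + bound delta))).
    apply: mean_le => //; apply: bdmeasD; [exact: bdmeas_max_empirical|exact: bdmeas_cst].
  rewrite meanD ?mean_cst ?lerD2r//; [exact: bdmeas_max_empirical|exact: bdmeas_cst].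
have b20 : 0 < 2 * b by rewrite mulr_gt0.
have lb : lam * (32 * (2 * b)) <= 1.
  by rewrite (_ : 32 * (2 * b) = 64 * b) //; ring.
have mgf := max_sum_mgf p0 p1 b20 gb g0 gv EZ lam_gt0 lb.
have mA : measurable [set om | max_empirical om > a].
  exact: measurable_gt bdmeas_max_empirical.1.
apply: (@le_trans _ _ ((expR (lam * (a - bound delta)))^-1 *
    \int[Pr]_om expR (lam * max_sum g (Y om)))).
  apply: (@prob_gt_le_mean _ _ _ Pr (fun om => expR (lam * max_sum g (Y om)))) => //.
  - exact: expR_gt0.
  - exact: (bYG (fun y => expR (lam * max_sum g y))).
  move=> om /= aom; rewrite ler_expR ler_wpM2l ?(ltW lam_gt0)//.
  by have := lo om; lra.
rewrite -expRN expRD ler_wpM2l ?expR_ge0//.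
by rewrite (mean_discrete_sample xi_iid mc (fun y => expR (lam * max_sum g y))).
Qed.

Lemma max_empirical_tail :
  fine (Pr [set om | max_empirical om > a])
  <= expR (- (lam * a) + 2 * lam * (m + 16 * n%:R * v * lam)).
Proof.
set p := fine _.
have [p0|p0] := leP p 0; first by rewrite (le_trans p0)// expR_ge0.
rewrite -[p]lnK ?posrE// ler_expR.
apply/ler_addgt0Pr => e e0.
(* The coefficients of [delta] and [delta^2] in the exponent of [discretized_tail], merged thanks to
   [delta <= 1]. *)
pose C := 6 * lam * n%:R + 128 * n%:R * lam ^+ 2.
have C0 : 0 <= C.
  by rewrite addr_ge0 ?mulr_ge0 ?sqr_ge0 ?ler0n ?(ltW lam_gt0).
have C1 : 0 < C + 1 by lra.
pose delta := Num.min 1 (Num.min (b / 2) (e / (C + 1))).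
have d0 : 0 < delta by rewrite !lt_min ltr01/= !divr_gt0.
have d1 : delta <= 1 by rewrite ge_min lexx.
have db : delta <= b / 2 by rewrite !ge_min lexx orbT.
have de : delta <= e / (C + 1) by rewrite !ge_min lexx !orbT.
have := discretized_tail d0 db; rewrite -/p -[p]lnK ?posrE// ler_expR expRK.
move=> /le_trans; apply.
have h1 : C * delta <= e.
  apply: (@le_trans _ _ ((C + 1) * delta)); first by rewrite ler_wpM2r ?lerDl// ltW.
  by rewrite -ler_pdivlMl// mulrC.
have h2 : delta ^+ 2 <= delta by rewrite expr2 ler_piMr// ltW.
have h3 : 128 * n%:R * lam ^+ 2 * delta ^+ 2 <= 128 * n%:R * lam ^+ 2 * delta.
  by apply: ler_wpM2l => //; rewrite mulr_ge0 ?sqr_ge0.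
rewrite /bound.
have -> : - (lam * (a - 2 * n%:R * delta)) + 2 * lam * (m + 2 * n%:R * delta +
   8 * (n%:R * (2 * v + 8 * delta ^+ 2)) * lam) =
   - (lam * a) + 2 * lam * (m + 16 * n%:R * v * lam) + (6 * lam * n%:R * delta + 128 * n%:R * lam ^+ 2 * delta ^+ 2).
  by ring.
rewrite lerD2l; apply: le_trans h1.
by rewrite /C [leRHS]mulrDl lerD2l.
Qed.

End Concentration.

(** * Localization *)

Section ClassC1.
Context (R : realType).
Implicit Types (psi : R -> R).

Lemma classC1_scale psi (c x : R) : classC1 psi -> 0 < x -> 1 <= c ->
  psi (c * x) <= c * psi x.
Proof.
move=> [_ _ _ psi_div _] x0 c1.
have c0 : 0 < c by rewrite (lt_le_trans _ c1).
have := psi_div x (c * x) x0; rewrite ler_peMl ?(ltW x0)// => /(_ isT).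
rewrite ler_pdivrMr ?mulr_gt0//.
by rewrite (_ : psi x / x * (c * x) = c * psi x)//; field; rewrite gt_eqF.
Qed.

Lemma classC1_ge_id psi (x : R) : classC1 psi -> 0 < x -> x <= 1 -> x <= psi x.
Proof.
move=> [_ _ _ psi_div psi1] x0 x1; have := psi_div x 1 x0 x1.
by rewrite divr1 => /(le_trans psi1); rewrite ler_pdivlMr// mul1r.
Qed.

Lemma classC1_ge1 psi (x : R) : classC1 psi -> 1 <= x -> 1 <= psi x.
Proof. by move=> [_ psi_mono _ _ psi1] x1; rewrite (le_trans psi1)// psi_mono. Qed.

Context (phi w : R -> R) (n : nat) (eps : R).
Hypotheses (phiC1 : classC1 phi) (wC1 : classC1 w) (n_gt0 : (0 < n)%N).
Hypotheses (eps_gt0 : 0 < eps) (eps_le1 : eps <= 1).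
Hypothesis eps_eq : Num.sqrt n%:R * eps ^+ 2 = phi (w eps).

Let sqrtn_gt0 : 0 < Num.sqrt n%:R :> R.
Proof. by rewrite sqrtr_gt0 ltr0n. Qed.

Let sqr_sqrtn : Num.sqrt n%:R ^+ 2 = n%:R :> R.
Proof. by rewrite sqr_sqrtr// ler0n. Qed.

Lemma w_eps_ge : eps <= w eps.
Proof. exact: classC1_ge_id. Qed.

Let w_eps_gt0 : 0 < w eps.
Proof. exact: lt_le_trans w_eps_ge. Qed.

(** Since [eps <= w eps], monotonicity gives [phi (w eps) >= phi eps >= eps], that is
    [sqrt n * eps >= 1]. This is what keeps [lam] of order [c ^+ 2 / n] admissible for functions
    bounded by [2 / x ^+ 2]. *)
Lemma n_eps_ge1 : 1 <= n%:R * eps ^+ 2.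
Proof.
have h : 1 <= Num.sqrt n%:R * eps.
  rewrite -(ler_pM2r eps_gt0) mul1r -mulrA -expr2 eps_eq.
  apply: (@le_trans _ _ (phi eps)); first exact: classC1_ge_id.
  by have [_ mono _ _ _] := phiC1; apply: mono w_eps_ge; exact: ltW.
by rewrite -sqr_sqrtn -exprMn exprn_ege1.
Qed.

Lemma phi_w_scale (c : R) : 1 <= c ->
  phi (2 * w (c * eps)) <= 2 * c * (Num.sqrt n%:R * eps ^+ 2).
Proof.
move=> c1; rewrite eps_eq; have [_ mono _ _ _] := phiC1.
have c0 : 0 <= c by rewrite (le_trans _ c1).
have [w0 _ _ _ _] := wC1.
apply: (@le_trans _ _ (phi (2 * c * w eps))).
  apply: mono; first by rewrite mulr_ge0// w0 ?mulr_ge0 ?(ltW eps_gt0).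
  by rewrite -mulrA ler_wpM2l// classC1_scale.
by apply: classC1_scale => //; lra.
Qed.

(** Makes the modulus hypothesis available at every radius from [w eps] on: [phi] grows at most
    linearly from its value at [w eps], and [eps ^+ 2 <= w eps * sigma]. *)
Lemma phi_le_quad (sigma : R) : w eps <= sigma ->
  phi sigma <= Num.sqrt n%:R * sigma ^+ 2.
Proof.
move=> ws; have s0 : 0 < sigma by exact: lt_le_trans ws.
have c1 : 1 <= sigma / w eps by rewrite ler_pdivlMr// mul1r.
have := classC1_scale phiC1 w_eps_gt0 c1; rewrite divfK ?gt_eqF// -eps_eq.
move=> /le_trans; apply.
rewrite (_ : sigma / w eps * _ = Num.sqrt n%:R * (sigma * (eps * eps / w eps))); last by ring.
rewrite ler_wpM2l ?(ltW sqrtn_gt0)//.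
rewrite [leRHS]expr2 ler_wpM2l ?(ltW s0)//.
rewrite ler_pdivrMr// ler_pM ?(ltW eps_gt0)//.
  exact: le_trans w_eps_ge ws.
exact: w_eps_ge.
Qed.

(* [v] is a variance; the bound [v <= 4] handles the case [w eps > 1], where
   [n eps^4 >= 1], and the bound through [w] handles [w eps <= 1], where
   [w eps <= phi (w eps) = sqrt n * eps^2]. *)
Lemma normalized_variance_le (c r v : R) : 1 <= c -> (c * eps) ^+ 2 <= r ->
  0 <= v -> v <= 4 -> v <= 4 * w (Num.sqrt r) ^+ 2 ->
  v / r ^+ 2 <= 4 * n%:R / c ^+ 2.
Proof.
move=> c1 cr v0 v4 vw.
have c0 : 0 < c by rewrite (lt_le_trans _ c1).
have ce0 : 0 < c * eps by rewrite mulr_gt0.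
have r0 : 0 < r by rewrite (lt_le_trans _ cr)// exprn_gt0.
have sr : c * eps <= Num.sqrt r.
  by rewrite -(ler_sqrt _ (ltW r0)) sqrtr_sqr gtr0_norm in cr.
rewrite ler_pdivrMr ?exprn_gt0// mulrAC ler_pdivlMr ?exprn_gt0//.
have [w1|w1] := leP (w eps) 1.
  have we : w eps <= Num.sqrt n%:R * eps ^+ 2.
    by rewrite eps_eq; exact: classC1_ge_id.
  have er : 1 <= Num.sqrt r / eps.
    by rewrite ler_pdivlMr// mul1r (le_trans _ sr)// ler_peMl// ltW.
  have := classC1_scale wC1 eps_gt0 er; rewrite divfK ?gt_eqF// => wr.
  have wr2 : w (Num.sqrt r) <= Num.sqrt r * Num.sqrt n%:R * eps.
    apply: (le_trans wr).
    apply: (@le_trans _ _ (Num.sqrt r / eps * (Num.sqrt n%:R * eps ^+ 2))).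
      by rewrite ler_wpM2l// divr_ge0// ltW.
    rewrite le_eqVlt; apply/orP; left; apply/eqP; field; by rewrite gt_eqF.
  have w0 : 0 <= w (Num.sqrt r) by have [w0 _ _ _ _] := wC1; apply: w0.
  have wr3 : w (Num.sqrt r) ^+ 2 <= r * n%:R * eps ^+ 2.
    rewrite -sqr_sqrtn -[X in X * _ * _](sqr_sqrtr (ltW r0)) -!exprMn.
    by rewrite lerXn2r ?nnegrE// (le_trans w0).
  apply: (@le_trans _ _ (4 * (r * n%:R * eps ^+ 2) * c ^+ 2)).
    by rewrite ler_wpM2r ?sqr_ge0// (le_trans vw)// ler_wpM2l.
  rewrite (_ : 4 * (r * n%:R * eps ^+ 2) * c ^+ 2 = 4 * n%:R * r * (c * eps) ^+ 2); last by ring.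
  by rewrite (expr2 r) [leRHS]mulrA ler_wpM2l// !mulr_ge0 ?(ltW r0).
have e4 : 1 <= n%:R * eps ^+ 4.
  have h : 1 <= Num.sqrt n%:R * eps ^+ 2.
    by rewrite eps_eq; apply: classC1_ge1 => //; exact: ltW.
  rewrite -sqr_sqrtn (_ : 4 = 2 * 2)%N// exprM -exprMn.
  exact: exprn_ege1.
have r2 : c ^+ 4 * eps ^+ 4 <= r ^+ 2.
  rewrite -exprMn (_ : 4 = 2 * 2)%N// exprM lerXn2r ?nnegrE ?sqr_ge0//.
  exact: ltW.
have c24 : c ^+ 2 <= c ^+ 4 by rewrite ler_weXn2l.
apply: (@le_trans _ _ (4 * c ^+ 2)); first by rewrite ler_wpM2r ?sqr_ge0.
rewrite -mulrA ler_wpM2l//.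
apply: (@le_trans _ _ (n%:R * (c ^+ 4 * eps ^+ 4))); last by rewrite ler_wpM2l.
by rewrite mulrCA (le_trans c24)// ler_peMr// exprn_ge0// ltW.
Qed.

End ClassC1.

(** * Relative risks and deviations of the empirical process *)

Lemma countable_range (T : choiceType) (A : set T) : countable A -> A !=set0 ->
  exists e : nat -> T, A = range e.
Proof.
move=> /countable_injP[f finj] [t0 At0].
pose e k := xget t0 [set t | A t /\ f t = k].
exists e; apply/seteqP; split => [t At|_ [k _ <-]].
  exists (f t) => //; rewrite /e; case: xgetP => [t' _ [At' ff]|/(_ t)/=].
    by apply: finj => //; exact: mem_set.
  by move=> /(_ (conj At erefl)).
by rewrite /e; case: xgetP => [t' _ []|].
Qed.

Section EmpiricalProcess.
Context (R : realType) (dO dZ dS : measure_display)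
    (Omega : measurableType dO) (Z : measurableType dZ)
    (SS : measurableType dS)
    (Pr : probability Omega R) (P : probability Z R)
    (n : nat) (xi : 'I_n -> {RV Pr >-> Z})
    (gamma : SS -> Z -> R) (s : SS).
Hypothesis n_gt0 : (0 < n)%N.
Hypothesis gamma01 : forall t z, 0 <= gamma t z <= 1.
Hypothesis mgamma : forall t, measurable_fun [set: Z] (gamma t).
Hypothesis s_min : forall t, risk P gamma s <= risk P gamma t.

Local Notation ell := (ell P gamma s).

Lemma bdmeas_gamma t : bdmeas (gamma t).
Proof.
split; first exact: mgamma.
by exists 1 => z; have /andP[g0 g1] := gamma01 t z; rewrite ger0_norm.
Qed.

Lemma ellE t : ell t = risk P gamma t - risk P gamma s.
Proof. by rewrite /Defs.ell meanB//; exact: bdmeas_gamma. Qed.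

Lemma ell_ge0 t : 0 <= ell t.
Proof. by rewrite ellE subr_ge0. Qed.

Lemma risk01 t : 0 <= risk P gamma t <= 1.
Proof.
rewrite /risk; apply/andP; split.
  by apply: Rintegral_ge0 => z _; have /andP[] := gamma01 t z.
rewrite -[leRHS](mean_cst P); apply: mean_le; [exact: bdmeas_gamma|exact: bdmeas_cst|].
by move=> z; have /andP[] := gamma01 t z.
Qed.

Lemma ell_le1 t : ell t <= 1.
Proof. by rewrite ellE; have /andP[_ ?] := risk01 t; have /andP[? _] := risk01 s; lra. Qed.

Lemma emp_risk_sample om t :
  emp_risk gamma (sample xi om) t = n%:R^-1 * \sum_(i < n) gamma t (xi i om).
Proof. by congr (_ * _); apply: eq_bigr => i _; rewrite tnth_mktuple. Qed.

Lemma emp_risk01 om t : 0 <= emp_risk gamma (sample xi om) t <= 1.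
Proof.
rewrite emp_risk_sample; apply/andP; split.
  rewrite mulr_ge0 ?invr_ge0 ?ler0n// sumr_ge0// => i _.
  by have /andP[] := gamma01 t (xi i om).
rewrite ler_pdivrMl ?ltr0n// mulr1.
apply: (@le_trans _ _ (\sum_(i < n) (1 : R))).
  by apply: ler_sum => i _; have /andP[] := gamma01 t (xi i om).
by rewrite sumr_const card_ord.
Qed.

Lemma bdmeas_emp_risk t : bdmeas (fun om => emp_risk gamma (sample xi om) t).
Proof.
have -> : (fun om => emp_risk gamma (sample xi om) t) =
    (fun om => n%:R^-1 * \sum_(i < n) gamma t (xi i om)).
  by apply/funext => om; exact: emp_risk_sample.
apply: bdmeasZ; apply: bdmeas_sum => i.
by apply: (@bdmeas_xi _ _ _ _ _ _ _ xi i (gamma t)); exact: bdmeas_gamma.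
Qed.

(** Signed so that [ell t - ell u] is the difference of the empirical risks of [t] and [u] plus this
    term. *)
Definition deviation (u t : SS) (om : Omega) : R :=
  centered_emp_risk P gamma (sample xi om) u
  - centered_emp_risk P gamma (sample xi om) t.

Lemma bdmeas_deviation u t : bdmeas (deviation u t).
Proof.
apply: bdmeasB; (apply: bdmeasB; [exact: bdmeas_emp_risk|exact: bdmeas_cst]).
Qed.

Lemma deviation_le2 u t om : `|deviation u t om| <= 2.
Proof.
rewrite /deviation /centered_emp_risk ler_norml.
have /andP[? ?] := emp_risk01 om t; have /andP[? ?] := emp_risk01 om u.
have /andP[? ?] := risk01 t; have /andP[? ?] := risk01 u.
by apply/andP; split; lra.
Qed.

Lemma deviation_le_sup (A : set SS) u t om : A t ->
  deviation u t om <= sup [set deviation u t om | t in A].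
Proof.
move=> At; apply: ub_le_sup; last by exists t.
exists 2 => _ [t' _ <-]; apply: le_trans (deviation_le2 u t' om).
exact: ler_norm.
Qed.

Lemma bdmeas_sup_deviation (A : set SS) u : countable A -> A !=set0 ->
  bdmeas (fun om => sup [set deviation u t om | t in A]).
Proof.
move=> cA A0; have [e Ae] := countable_range cA A0.
have := @bdmeas_sups _ _ _ (fun k => deviation u (e k)) 2
  (fun k => (bdmeas_deviation u (e k)).1) (fun k om => deviation_le2 u (e k) om).
congr bdmeas; apply/funext => om; congr sup; rewrite Ae; apply/seteqP.
split => [_ [k _ <-]|_ [_ [k _ <-] <-]]; last by exists k.
by exists (e k) => //; exists k.
Qed.

End EmpiricalProcess.

(** * Peeling over shells of the relative risk *)

Lemma sum_half_pow_le2 (R : realType) (k : nat) :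
  \sum_(i < k) (2^-1 : R) ^+ i <= 2.
Proof.
suff -> : \sum_(i < k) (2^-1 : R) ^+ i = 2 - 2 * 2^-1 ^+ k.
  by rewrite gerBl mulr_ge0// exprn_ge0// invr_ge0.
elim: k => [|k IH]; first by rewrite big_ord0 expr0 mulr1 subrr.
by rewrite big_ord_recr/= IH exprS; field.
Qed.

Section Peeling.
Context (R : realType) (dO dZ dS : measure_display)
    (Omega : measurableType dO) (Z : measurableType dZ)
    (SS : measurableType dS)
    (Pr : probability Omega R) (P : probability Z R)
    (n : nat) (xi : 'I_n -> {RV Pr >-> Z})
    (gamma : SS -> Z -> R) (s : SS) (d : SS -> SS -> R)
    (phi w : R -> R) (S' : set SS) (eps c : R) (u : SS).
Hypothesis n_gt0 : (0 < n)%N.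
Hypothesis xi_iid : iid P xi.
Hypothesis gamma01 : forall t z, 0 <= gamma t z <= 1.
Hypothesis mgamma : forall t, measurable_fun [set: Z] (gamma t).
Hypothesis s_min : forall t, risk P gamma s <= risk P gamma t.
Hypothesis d_pseudo : pseudo_distance d.
Hypothesis d_var : forall t,
  ('V_P[fun z => (gamma t z - gamma s z)%R] <= (d s t ^+ 2)%:E)%E.
Hypotheses (phiC1 : classC1 phi) (wC1 : classC1 w).
Hypothesis S'_countable : countable S'.
Hypothesis d_w : forall t, d s t <= w (Num.sqrt (ell P gamma s t)).
Hypothesis sup_phi : forall u, S' u -> forall sigma : R, 0 < sigma ->
  phi sigma <= Num.sqrt n%:R * sigma ^+ 2 ->
  ((Num.sqrt n%:R)%:E *
   'E_Pr[fun omega =>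
     (sup [set centered_emp_risk P gamma (sample xi omega) u
               - centered_emp_risk P gamma (sample xi omega) t
          | t in [set t | S' t /\ d u t <= sigma]])%R]
   <= (phi sigma)%:E)%E.
Hypotheses (eps_gt0 : 0 < eps) (eps_le1 : eps <= 1).
Hypothesis eps_eq : Num.sqrt n%:R * eps ^+ 2 = phi (w eps).
Hypothesis S'u : S' u.
Hypothesis c_ge1 : 1 <= c.
Hypothesis u_near_best : forall t, S' t ->
  ell P gamma s u <= ell P gamma s t + (c * eps) ^+ 2.

Local Notation ell := (ell P gamma s).
Local Notation dev := (deviation P xi gamma).

Let x := c * eps.
Let r t := ell t + x ^+ 2.

Let c_gt0 : 0 < c. Proof. exact: lt_le_trans c_ge1. Qed.
Let x_gt0 : 0 < x. Proof. by rewrite mulr_gt0. Qed.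
Let ell0 t : 0 <= ell t. Proof. exact: ell_ge0. Qed.
Let r_ge t : x ^+ 2 <= r t. Proof. by rewrite lerDr. Qed.
Let r_gt0 t : 0 < r t.
Proof. by rewrite (lt_le_trans _ (r_ge t))// exprn_gt0. Qed.

(** On shell [i] both [ell t] and [ell u] are at most [4 ^+ i.+1 * x ^+ 2], so each of [d s t] and
    [d s u] is at most [w (2 ^+ i.+1 * x)]; the triangle inequality through [s] adds them. *)
Let sigma (i : nat) := 2 * w (2 ^+ i.+1 * x).
Let A (i : nat) := [set t | S' t /\ d u t <= sigma i].
Let G (i : nat) om := sup [set dev u t om | t in A i].

Let pow_ge1 i : 1 <= 2 ^+ i :> R.
Proof. by rewrite exprn_ege1// ler1n. Qed.

Let sigma_ge i : w eps <= sigma i.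
Proof.
have [w0 wmono _ _ _] := wC1.
have h : eps <= 2 ^+ i.+1 * x.
  rewrite /x mulrA ler_peMl ?(ltW eps_gt0)//.
  exact: mulr_ege1.
have h1 := wmono _ _ (ltW eps_gt0) h.
have h2 := w0 _ (ltW eps_gt0).
rewrite /sigma; lra.
Qed.

Let w_eps_gt0 : 0 < w eps.
Proof. exact: lt_le_trans (w_eps_ge wC1 eps_gt0 eps_le1). Qed.

Let sigma_ge0 i : 0 <= sigma i.
Proof. exact: le_trans (ltW w_eps_gt0) (sigma_ge i). Qed.

Let Au i : A i u.
Proof. by have [_ duu _ _] := d_pseudo; split => //; rewrite duu. Qed.

Let G_ge0 i om : 0 <= G i om.
Proof.
have := deviation_le_sup P xi n_gt0 gamma01 mgamma u om (Au i).
by rewrite {1}/deviation subrr.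
Qed.

Let bdmeas_G i : bdmeas (G i).
Proof.
apply: bdmeas_sup_deviation => //; last by exists u; exact: Au.
by apply: sub_countable S'_countable; apply: subset_card_le => t [].
Qed.

(** The mean grows like [2 ^+ i] only, by sublinearity of [phi] and [w], whereas the weights on the
    shells grow like [4 ^+ i]. *)
Let mean_G i : \int[Pr]_om G i om <= 2 ^+ i.+2 * c * eps ^+ 2.
Proof.
have sg0 : 0 < sigma i by exact: lt_le_trans (sigma_ge i).
have := sup_phi S'u sg0 (phi_le_quad phiC1 wC1 n_gt0 eps_gt0 eps_le1 eps_eq (sigma_ge i)).
rewrite (bdmeas_mean Pr (bdmeas_G i)) -EFinM lee_fin => h.
have sn : 0 < Num.sqrt n%:R :> R by rewrite sqrtr_gt0 ltr0n.
rewrite -(ler_pM2l sn) (le_trans h)//.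
rewrite /sigma /x mulrA.
apply: (le_trans (phi_w_scale phiC1 wC1 eps_gt0 eps_le1 eps_eq _)).
  exact: mulr_ege1.
by rewrite le_eqVlt; apply/orP; left; apply/eqP; rewrite (exprS 2 i.+1); ring.
Qed.

(** The least admissible [i]: minimality gives the second bound, except for [i = 0], where
    [x ^+ 2 <= r t] does. As [ell] is at most 1, finitely many shells suffice, and no infinite
    series appears. *)
Lemma ell_shell (t : SS) (k : nat) : 1 <= 4 ^+ k * x ^+ 2 ->
  exists2 i : 'I_k.+1, ell t <= 4 ^+ i * x ^+ 2 & 4 ^+ i * x ^+ 2 <= 4 * r t.
Proof.
move=> xk.
have ex : exists i, ell t <= 4 ^+ i * x ^+ 2.
  by exists k; apply: le_trans xk; exact: ell_le1.
case: (ex_minnP ex) => i hi imin.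
have ik : (i < k.+1)%N by rewrite ltnS; apply: imin; apply: le_trans xk; exact: ell_le1.
exists (Ordinal ik) => //=.
case: i hi imin ik => [|i] hi imin ik.
  rewrite expr0 mul1r (le_trans (r_ge t))// ler_peMl ?ler1n// ltW//.
rewrite exprS -mulrA ler_pM2l// /r.
have : 4 ^+ i * x ^+ 2 < ell t.
  by rewrite ltNge; apply/negP => /imin; rewrite ltnn.
have := sqr_ge0 x; lra.
Qed.

Let d_u_t t i : S' t -> ell t <= 4 ^+ i * x ^+ 2 -> d u t <= sigma i.
Proof.
move=> S't lt; have [_ _ dC dT] := d_pseudo.
apply: (le_trans (dT u s t)); rewrite (dC u s).
have [w0 wmono _ _ _] := wC1.
have y0 : 0 <= 2 ^+ i.+1 * x by rewrite mulr_ge0 ?(ltW x_gt0)// exprn_ge0.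
have aux t' : ell t' <= 4 * (4 ^+ i * x ^+ 2) -> d s t' <= w (2 ^+ i.+1 * x).
  move=> h; apply: (le_trans (d_w t')); apply: wmono; first exact: sqrtr_ge0.
  rewrite -[leRHS]ger0_norm// -sqrtr_sqr ler_wsqrtr// (le_trans h)//.
  rewrite (_ : (2 ^+ i.+1 * x) ^+ 2 = 4 * (4 ^+ i * x ^+ 2))//.
  rewrite exprMn exprAC (_ : 2 ^+ 2 = 4 :> R); last by ring.
  by rewrite exprS mulrA.
have z0 : x ^+ 2 <= 4 ^+ i * x ^+ 2.
  by rewrite ler_peMl ?sqr_ge0// exprn_ege1// ler1n.
rewrite /sigma mulr_natl mulr2n lerD//; apply: aux; last by have := sqr_ge0 x; lra.
have := u_near_best S't; rewrite -/x; have := sqr_ge0 x; lra.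
Qed.

(** Only the shell of [t] matters; the other nonnegative terms are added to obtain a bound
    independent of [t] whose mean is linear. *)
Let ratio t om k : S' t -> 1 <= 4 ^+ k * x ^+ 2 ->
  dev u t om / r t <= \sum_(i < k.+1) 4 / (4 ^+ i * x ^+ 2) * G i om.
Proof.
move=> S't xk; have [i li ri] := ell_shell t xk.
have fx (j : nat) : 0 < 4 ^+ j * x ^+ 2 by rewrite mulr_gt0// exprn_gt0.
rewrite (bigD1 i)//= (le_trans (y := 4 / (4 ^+ i * x ^+ 2) * G i om))//; last first.
  rewrite lerDl sumr_ge0// => j _; rewrite mulr_ge0// divr_ge0//; exact: ltW.
have At : A i t by split => //; exact: d_u_t.
apply: (@le_trans _ _ (G i om / r t)).
  rewrite ler_pM2r ?invr_gt0//; exact: deviation_le_sup.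
rewrite mulrC ler_wpM2r//.
by rewrite ler_pdivlMr// ler_pdivrMl// [leRHS]mulrC.
Qed.

Context (N : nat) (e : 'I_N.+1 -> SS).
Hypothesis S'e : forall j, S' (e j).

(* Peeling: on the shell [4^(i-1) x^2 < ell t <= 4^i x^2] the deviation is at
   most [G i] and the denominator at least [4^(i-1) x^2]. *)
Lemma mean_max_ratio :
  \int[Pr]_om max_ord (fun j => dev u (e j) om / r (e j)) <= 32 / c.
Proof.
have [k xk] : exists k, 1 <= 4 ^+ k * x ^+ 2.
  pose k := (Num.truncn (x ^- 2)).+1; exists k.
  rewrite -ler_pdivrMr ?exprn_gt0// div1r.
  have h : x ^- 2 <= k%:R by apply: ltW; apply: truncnS_gt.
  apply: (le_trans h); rewrite -natrX ler_nat.
  by apply: ltnW; apply: ltn_expl.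
apply: (@le_trans _ _ (\int[Pr]_om (\sum_(i < k.+1) 4 / (4 ^+ i * x ^+ 2) * G i om))).
  apply: mean_le.
  - apply: bdmeas_max_ord => j.
    have := bdmeasZ (r (e j))^-1 (bdmeas_deviation P xi gamma01 mgamma u (e j)).
    by congr bdmeas; apply/funext => om; rewrite mulrC.
  - by apply: bdmeas_sum => i; apply: bdmeasZ; exact: bdmeas_G.
  - by move=> om; exact: ratio.
rewrite mean_sum; last by move=> i; apply: bdmeasZ; exact: bdmeas_G.
(* The factor [eps ^+ 2] of [mean_G] cancels against [x ^+ 2 = (c * eps) ^+ 2], leaving one power of
   [c] in the denominator. *)
apply: (@le_trans _ _ (\sum_(i < k.+1) 16 / c * 2^-1 ^+ i)).
  apply: ler_sum => i _; rewrite meanZ; last exact: bdmeas_G.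
  apply: (@le_trans _ _ (4 / (4 ^+ i * x ^+ 2) * (2 ^+ i.+2 * c * eps ^+ 2))).
    by rewrite ler_wpM2l// divr_ge0// mulr_ge0 ?exprn_ge0// ltW.
  rewrite le_eqVlt; apply/orP; left; apply/eqP.
  rewrite /x (_ : 4 ^+ i = 2 ^+ i * 2 ^+ i :> R); last first.
    by rewrite -exprMn; congr (_ ^+ i); ring.
  rewrite !exprS exprVn; field.
  by rewrite !gt_eqF// exprn_gt0.
rewrite -mulr_sumr.
apply: (@le_trans _ _ (16 / c * 2)).
  by rewrite ler_wpM2l ?sum_half_pow_le2// divr_ge0// ltW.
by rewrite mulrAC -natrM.
Qed.

Let num (t : SS) (z : Z) : R :=
  gamma u z - gamma t z - (risk P gamma u - risk P gamma t).

Let f (j : 'I_N.+1) (z : Z) : R := num (e j) z / r (e j).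

Let bdmeas_num t : bdmeas (num t).
Proof.
by apply: bdmeasB; [apply: bdmeasB; exact: bdmeas_gamma | exact: bdmeas_cst].
Qed.

Let num_le2 t z : `|num t z| <= 2.
Proof.
rewrite /num ler_norml; have /andP[? ?] := gamma01 t z; have /andP[? ?] := gamma01 u z.
have /andP[? ?] := risk01 P gamma01 mgamma t; have /andP[? ?] := risk01 P gamma01 mgamma u.
by apply/andP; split; lra.
Qed.

Let centered_s t z := gamma t z - gamma s z - ell t.

Let bdmeas_centered_s t : bdmeas (centered_s t).
Proof.
by apply: bdmeasB; [apply: bdmeasB; exact: bdmeas_gamma | exact: bdmeas_cst].
Qed.

Let variance_le t : \int[P]_z (centered_s t z ^+ 2) <= d s t ^+ 2.
Proof.
rewrite -lee_fin; apply: le_trans (d_var t).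
rewrite /variance unlock.
have bX : bdmeas (fun z => gamma t z - gamma s z) by apply: bdmeasB; exact: bdmeas_gamma.
rewrite (bdmeas_mean P bX)/= -(bdmeas_mean P); last exact: bdmeasX.
by rewrite le_eqVlt; apply/orP; left; apply/eqP; congr expectation.
Qed.

(** Variances are controlled only for differences with [s], so [num t] is split as
    [centered_s u - centered_s t]; near-optimality gives [ell u <= r t], and both parts obey the
    same bound. *)
Let num_variance t : S' t -> \int[P]_z (num t z ^+ 2) <= 4 * w (Num.sqrt (r t)) ^+ 2.
Proof.
move=> S't.
have [w0 wmono _ _ _] := wC1; have [d0 _ _ _] := d_pseudo.
have aux t' : ell t' <= r t -> \int[P]_z (centered_s t' z ^+ 2) <= w (Num.sqrt (r t)) ^+ 2.
  move=> t'r; apply: (le_trans (variance_le _)).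
  rewrite lerXn2r ?nnegrE//; first by rewrite w0// sqrtr_ge0.
  by apply: (le_trans (d_w t')); rewrite wmono ?sqrtr_ge0// ler_wsqrtr.
apply: (@le_trans _ _ (\int[P]_z (2 * centered_s u z ^+ 2 + 2 * centered_s t z ^+ 2))).
  apply: mean_le.
  - exact: bdmeasX.
  - by apply: bdmeasD; apply: bdmeasZ; exact: bdmeasX.
  move=> z; rewrite (_ : num t z = centered_s u z - centered_s t z).
    by have := sqr_ge0 (centered_s u z + centered_s t z); nra.
  by rewrite /num /centered_s !ellE//; ring.
rewrite meanD; [|by apply: bdmeasZ; exact: bdmeasX..].
rewrite !meanZ; [|exact: bdmeasX..].
have h1 := aux u (u_near_best S't).
have h2 : ell t <= r t by rewrite lerDl sqr_ge0.
rewrite (_ : 4 * _ = 2 * w (Num.sqrt (r t)) ^+ 2 + 2 * w (Num.sqrt (r t)) ^+ 2); last by ring.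
apply: lerD; rewrite (ler_pM2l (ltr0n R 2)); [exact: h1|exact: aux].
Qed.

Lemma finite_deviation_tail (y : R) : 1 <= y -> c ^+ 2 = 2 ^+ 18 * y ->
  fine (Pr [set om | max_ord (fun j => dev u (e j) om / r (e j)) > 2^-1])
  <= expR (- y).
Proof.
move=> y1 cy.
have nR : 0 < n%:R :> R by rewrite ltr0n.
have fsum j om : \sum_i f j (xi i om) = n%:R * (dev u (e j) om / r (e j)).
  rewrite /f -mulr_suml mulrA; congr (_ / _).
  rewrite /num /deviation /centered_emp_risk !emp_risk_sample sumrB sumr_const card_ord.
  by rewrite -[X in _ - X = _]mulr_natl sumrB; field; rewrite gt_eqF.
have maxE om : max_empirical xi f om = n%:R * max_ord (fun j => dev u (e j) om / r (e j)).
  rewrite /max_empirical; apply/eqP; rewrite eq_le; apply/andP; split.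
    by rewrite {1}/max_ord fsum ler_pM2l//; exact: (argmax_ordP (fun j => dev u (e j) om / r (e j))).
  rewrite /max_ord -fsum; exact: (argmax_ordP (fun j => \sum_i f j (xi i om))).
have bf j : bdmeas (f j).
  have := bdmeasZ (r (e j))^-1 (bdmeas_num (e j)).
  by congr bdmeas; apply/funext => z; rewrite mulrC.
have x2 : 0 < x ^+ 2 by rewrite exprn_gt0.
have fb j z : `|f j z| <= 2 / x ^+ 2.
  rewrite normrM normfV (gtr0_norm (r_gt0 _)) ler_pM ?invr_ge0 ?(ltW (r_gt0 _))//.
  by rewrite lef_pV2 ?posrE.
have b0 : 0 < 2 / x ^+ 2 by rewrite divr_gt0.
have f0 j : \int[P]_z f j z = 0.
  rewrite -[RHS](mulr0 (r (e j))^-1) (_ : 0 = \int[P]_z num (e j) z).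
    by rewrite -meanZ//; apply: eq_Rintegral => z _; rewrite mulrC.
  rewrite meanB ?mean_cst; [|apply: bdmeasB; exact: bdmeas_gamma|exact: bdmeas_cst].
  by rewrite meanB ?subrr//; exact: bdmeas_gamma.
have fv j : \int[P]_z (f j z ^+ 2) <= 4 * n%:R / c ^+ 2.
  have bn2 : bdmeas (fun z => num (e j) z ^+ 2) by exact: bdmeasX.
  apply: (@le_trans _ _ ((\int[P]_z (num (e j) z ^+ 2)) / r (e j) ^+ 2)).
    rewrite mulrC -meanZ// le_eqVlt; apply/orP; left; apply/eqP.
    by apply: eq_Rintegral => z _; rewrite /f exprMn exprVn mulrC.
  apply: (normalized_variance_le phiC1 wC1 eps_gt0 eps_le1 eps_eq) => //.
  - by apply: Rintegral_ge0 => z _; exact: sqr_ge0.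
  - rewrite -[leRHS](mean_cst P); apply: mean_le => //; first exact: bdmeas_cst.
    move=> z; rewrite (_ : 4 = 2 ^+ 2 :> R); last by ring.
    by rewrite -real_normK ?num_real// lerXn2r ?nnegrE.
  - exact: num_variance.
have bmax : bdmeas (fun om => max_ord (fun j => dev u (e j) om / r (e j))).
  apply: bdmeas_max_ord => j.
  have := bdmeasZ (r (e j))^-1 (bdmeas_deviation P xi gamma01 mgamma u (e j)).
  by congr bdmeas; apply/funext => om; rewrite mulrC.
have mm : \int[Pr]_om max_empirical xi f om <= n%:R * (32 / c).
  under eq_Rintegral do rewrite maxE.
  by rewrite meanZ// ler_pM2l//; exact: mean_max_ratio.
have [T T0 TE] : exists2 T : R, 0 < T & T = 1024.
  by exists 1024; rewrite ?ltr0n.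
(* With threshold [n / 2], mean [32 n / c] and variance [4 n / c ^+ 2], the exponent is
   [T^-1 * (- c^2 / 2 + 64 c + 128 c^2 / T)]. For [T = 1024] and [c >= 512] each positive term is at
   most [c^2 / 8], so the total is at most [- c^2 / (4 T) = - 64 y]. *)
pose lam := c ^+ 2 / T / n%:R.
have lam0 : 0 < lam by rewrite !divr_gt0// exprn_gt0.
have T128 : 128 / T = 8^-1 by rewrite TE; lra.
have ne1 := n_eps_ge1 phiC1 wC1 eps_gt0 eps_le1 eps_eq.
have lamb : lam * (64 * (2 / x ^+ 2)) <= 1.
  rewrite (_ : lam * _ = 128 / T / (n%:R * eps ^+ 2)); last first.
    by rewrite /lam /x; field; rewrite !gt_eqF.
  rewrite T128 ler_pdivrMr ?mulr_gt0 ?exprn_gt0//; lra.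
have := max_empirical_tail xi_iid (n%:R / 2) (fun j => (bf j).1) fb b0 f0 fv mm lam0 lamb.
rewrite (_ : [set om | max_empirical xi f om > n%:R / 2] =
  [set om | max_ord (fun j => dev u (e j) om / r (e j)) > 2^-1]); last first.
  by apply/seteqP; split => om /=; rewrite maxE ltr_pM2l.
move=> /le_trans; apply; rewrite ler_expR.
rewrite (_ : _ + _ = T^-1 * (- (c ^+ 2 / 2) + 64 * c + 128 / T * c ^+ 2)); last first.
  by rewrite /lam; field; rewrite !gt_eqF.
have A512 : 2 ^+ 9 = 512 :> R by rewrite -natrX.
have cy' : c ^+ 2 = 512 * 512 * y by rewrite cy (exprD 2 9 9) A512.
have c512 : 512 <= c.
  rewrite -(@ler_pXn2r _ 2) ?nnegrE ?ler0n ?(ltW c_gt0)// cy' expr2.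
  exact: (ler_peMr (mulr_ge0 (ler0n _ _) (ler0n _ _)) y1).
have c2 : 512 * c <= c ^+ 2 by rewrite expr2 ler_pM2r.
have y0 : 0 <= y by rewrite (le_trans _ y1).
apply: (@le_trans _ _ (T^-1 * (- (c ^+ 2 / 4)))).
  rewrite ler_pM2l ?invr_gt0// T128; lra.
rewrite -(ler_pM2l T0) mulrA divff ?gt_eqF// mul1r TE cy'; lra.
Qed.

End Peeling.

(** * From finite classes to the minimizer, and from tails to means *)

Lemma prob_bigcup_le (d : measure_display) (T : measurableType d) (R : realType)
    (Pr : probability T R) (F : nat -> set T) (q : R) :
  (forall k, measurable (F k)) -> nondecreasing_seq F ->
  (forall k, fine (Pr (F k)) <= q) -> (Pr (\bigcup_k F k) <= q%:E)%E.
Proof.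
move=> mF ndF Fq.
have mU : measurable (\bigcup_k F k) by exact: bigcupT_measurable.
have cv := nondecreasing_cvg_mu mF mU ndF.
apply: (cvge_to_le (cv _ Pr)).
apply: nearW => k /=; rewrite -[Pr (F k)]fineK ?fin_num_measure// lee_fin.
exact: Fq.
Qed.

(** A discrete layer-cake bound: apart from a first unit, [a] exceeds one further integer per unit
    of height. Truncation keeps the count finite. *)
Lemma min_le_count (R : realType) (a : R) (K : nat) :
  Num.min a K.+1%:R <= 1 + \sum_(k < K) (a > k.+1%:R)%R%:R.
Proof.
elim: K => [|K IH]; first by rewrite big_ord0 addr0 ge_min lexx orbT.
have [aK|aK] := leP a K.+1%:R.
  rewrite ge_min; apply/orP; left; rewrite big_ord_recr/= addrA.
  apply: (@le_trans _ _ (1 + \sum_(k < K) (a > k.+1%:R)%R%:R)); last by rewrite lerDl.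
  by apply: le_trans IH; rewrite le_min lexx.
rewrite (eq_bigr (fun=> 1)); last first.
  move=> k _; rewrite (_ : (a > k.+1%:R) = true)//.
  by rewrite (le_lt_trans _ aK)// ler_nat ltn_ord.
by rewrite sumr_const card_ord ge_min nat1r lexx orbT.
Qed.

Lemma sum_expRN_le1 (R : realType) (K : nat) :
  \sum_(k < K) expR (- k.+1%:R : R) <= 1.
Proof.
have e2 : expR (- 1 : R) <= 2^-1.
  by rewrite expRN lef_pV2 ?posrE ?expR_gt0//; exact: expR_ge1Dx.
apply: (@le_trans _ _ (2^-1 * \sum_(k < K) (2^-1 : R) ^+ k)).
  rewrite mulr_sumr; apply: ler_sum => k _.
  by rewrite -exprS -mulrN1 expRM_natl lerXn2r ?nnegrE ?expR_ge0 ?invr_ge0.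
by rewrite ler_pdivrMl// mulr1; exact: sum_half_pow_le2.
Qed.

(** The tail is known only for [y >= 1], so the first unit of [(X - B) / K] counts in full; the
    later ones contribute at most the sum of [expR (- k)] over [k >= 1], which is at most 1.
    Together they give [2 * K]. *)
Lemma mean_le_of_tail (d : measure_display) (T : measurableType d) (R : realType)
    (Pr : probability T R) (X : T -> R) (B K : R) :
  bdmeas X -> 0 < K ->
  (forall y : R, 1 <= y -> (Pr [set om | (X om > B + y * K)%R] <= (expR (- y))%:E)%E) ->
  \int[Pr]_om X om <= B + 2 * K.
Proof.
move=> bX K0 tail.
have [mX [M XM]] := bX.
pose N := Num.truncn ((M - B) / K).
pose A (k : nat) := [set om | X om > B + k.+1%:R * K].
have mA k : measurable (A k) by exact: measurable_gt.
have bA k : bdmeas (\1_(A k) : T -> R) by exact: bdmeas_indic.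
pose C om := B + K * (1 + \sum_(k < N) \1_(A k) om).
have bC1 : bdmeas (fun om => 1 + \sum_(k < N) (\1_(A k) om : R)).
  by apply: bdmeasD; [exact: bdmeas_cst | exact: bdmeas_sum].
have XC om : X om <= C om.
  rewrite -lerBlDl mulrC -ler_pdivrMr//.
  have aN : (X om - B) / K < N.+1%:R.
    apply: (@le_lt_trans _ _ ((M - B) / K)); last exact: truncnS_gt.
    by rewrite ler_pM2r ?invr_gt0// lerD2r (le_trans (ler_norm _)).
  have := min_le_count ((X om - B) / K) N.
  rewrite min_l ?(ltW aN)// => /le_trans; apply.
  rewrite lerD2l; apply: ler_sum => k _; rewrite indicE.
  rewrite (_ : (om \in A k) = ((X om - B) / K > k.+1%:R))//.
  by rewrite ltr_pdivlMr// ltrBrDl; apply/idP/idP => [/set_mem|h]//; exact/mem_set.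
apply: (@le_trans _ _ (\int[Pr]_om C om)).
  by apply: mean_le => //; apply: bdmeasD; [exact: bdmeas_cst | exact: bdmeasZ].
rewrite meanD ?mean_cst; [|exact: bdmeas_cst|exact: bdmeasZ].
rewrite lerD2l meanZ// mulrC ler_pM2r//.
rewrite meanD ?mean_cst; [|exact: bdmeas_cst|exact: bdmeas_sum].
rewrite mean_sum// (_ : 2 = 1 + 1 :> R)// lerD2l.
apply: le_trans (sum_expRN_le1 R N); apply: ler_sum => k _.
rewrite mean_indic// -lee_fin fineK ?fin_num_measure//.
by apply: tail; rewrite ler1n.
Qed.

Section Approximation.
Context (R : realType) (dZ : measure_display) (Z : measurableType dZ)
    (SS : Type) (P : probability Z R) (gamma : SS -> Z -> R).
Hypothesis gamma01 : forall t z, 0 <= gamma t z <= 1.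
Hypothesis mgamma : forall t, measurable_fun [set: Z] (gamma t).

Lemma risk_cvg (v : nat -> SS) (t : SS) :
  (forall z, (fun k => gamma (v k) z) @ \oo --> gamma t z) ->
  (fun k => risk P gamma (v k)) @ \oo --> risk P gamma t.
Proof.
move=> vt.
have g1 t' z : (`|(gamma t' z)%:E| <= 1%:E)%E.
  by have /andP[g0 g1] := gamma01 t' z; rewrite lee_fin ger0_norm.
have int1 t' : (\int[P]_z (gamma t' z)%:E)%E \is a fin_num.
  apply: integrable_fin_num => //; apply: bdmeas_integrable; split => //.
  by exists 1 => z; rewrite -lee_fin g1.
have mE t' : measurable_fun [set: Z] (fun z => (gamma t' z)%:E).
  exact/measurable_EFinP.
have gE z : (fun k => (gamma (v k) z)%:E) @ \oo --> (gamma t z)%:E.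
  by apply: cvg_EFin; [exact: nearW | exact: vt].
have [_ _ cv] := @dominated_convergence _ Z R P [set: Z] measurableT
  (fun k z => (gamma (v k) z)%:E) (fun z => (gamma t z)%:E) (fun=> 1%:E)
  (fun k => mE (v k)) (mE t) (aeW _ (fun z _ => gE z))
  (bdmeas_integrable P (bdmeas_cst Z 1)) (aeW _ (fun z k _ => g1 (v k) z)).
apply: fine_cvg; rewrite fineK//.
Qed.

Lemma emp_risk_cvg (n : nat) (x : n.-tuple Z) (v : nat -> SS) (t : SS) :
  (forall z, (fun k => gamma (v k) z) @ \oo --> gamma t z) ->
  (fun k => emp_risk gamma x (v k)) @ \oo --> emp_risk gamma x t.
Proof.
move=> vt; apply: cvgM; first exact: cvg_cst.
by apply: cvg_big => [|i _]; [exact: add_continuous | exact: vt].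
Qed.

End Approximation.

Section Localization.
Context (R : realType) (dO dZ dS : measure_display)
    (Omega : measurableType dO) (Z : measurableType dZ)
    (SS : measurableType dS)
    (Pr : probability Omega R) (P : probability Z R)
    (n : nat) (xi : 'I_n -> {RV Pr >-> Z})
    (gamma : SS -> Z -> R) (s : SS) (S S' : set SS).
Hypothesis gamma01 : forall t z, 0 <= gamma t z <= 1.
Hypothesis mgamma : forall t, measurable_fun [set: Z] (gamma t).
Hypothesis s_min : forall t, risk P gamma s <= risk P gamma t.
Hypothesis S_sep : separability gamma S S'.

Local Notation ell := (ell P gamma s).
Local Notation inf_ell := (ell_set P gamma s S).

Lemma inf_ell_le t : S t -> inf_ell <= ell t.
Proof.
move=> St; apply: ge_inf; last by exists t.
by exists 0 => _ [t' _ <-]; exact: ell_ge0.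
Qed.

Lemma ell_cvg (v : nat -> SS) (t : SS) :
  (forall z, (fun k => gamma (v k) z) @ \oo --> gamma t z) ->
  (fun k => ell (v k)) @ \oo --> ell t.
Proof.
move=> vt; rewrite ellE//.
rewrite (_ : (fun k => ell (v k)) = (fun k => risk P gamma (v k) - risk P gamma s)); last first.
  by apply/funext => k; rewrite ellE.
by apply: cvgB; [exact: risk_cvg | exact: cvg_cst].
Qed.

(** The infimum runs over [S], but the modulus hypothesis requires a point of [S']; pointwise
    approximation of the loss passes to [ell] by dominated convergence. *)
Lemma near_minimizer (e : R) : S !=set0 -> 0 < e ->
  exists2 u, S' u & ell u <= inf_ell + e.
Proof.
move=> [t0 St0] e0; have [_ _ sep] := S_sep.
have hinf : has_inf [set ell t | t in S].
  split; first by exists (ell t0), t0.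
  by exists 0 => _ [t' _ <-]; exact: ell_ge0.
have [_ [t St <-] ht] := inf_adherent e0 hinf.
have [v [S'v vt]] := sep t St.
have /= := cvgr_lt _ (ell_cvg vt) _ ht.
move=> [k _ hk]; exists (v k); first exact: S'v.
by apply: ltW; apply: (hk k) => /=.
Qed.

Hypothesis n_gt0 : (0 < n)%N.

(** The minimizer may lie outside [S'], so the deviation bound is first carried to it by a limit.
    Then [ell t <= ell u + rho + (ell t + x2) / 2]; solving for [ell t] doubles [rho] and [ell u],
    and [3 * x2] is the doubled gap of [u] plus the remaining [x2]. *)
Lemma minimizer_ell_le (rho x2 : R) (u t : SS) (om : Omega) : 0 <= x2 ->
  S t -> S u -> ell u <= inf_ell + x2 ->
  emp_risk gamma (sample xi om) t <=
    rho + inf [set emp_risk gamma (sample xi om) t | t in S] ->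
  (forall t, S' t -> deviation P xi gamma u t om <= (ell t + x2) / 2) ->
  ell t <= 2 * rho + 2 * inf_ell + 3 * x2.
Proof.
move=> x20 St Su u_near t_min dev_le; have [_ _ sep] := S_sep.
have [v [S'v vt]] := sep t St.
have dev_t : deviation P xi gamma u t om <= (ell t + x2) / 2.
  have cl : (fun k => deviation P xi gamma u (v k) om) @ \oo --> deviation P xi gamma u t om.
    apply: cvgB; first exact: cvg_cst.
    by apply: cvgB; [exact: emp_risk_cvg | exact: risk_cvg].
  have cr : (fun k => (ell (v k) + x2) / 2) @ \oo --> (ell t + x2) / 2.
    apply: cvgM; last exact: cvg_cst.
    by apply: cvgD; [exact: ell_cvg | exact: cvg_cst].
  by apply: (ler_cvg_to cl cr); apply: nearW => k; exact: dev_le.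
have inf_u : inf [set emp_risk gamma (sample xi om) t | t in S] <= emp_risk gamma (sample xi om) u.
  apply: ge_inf; last by exists u.
  by exists 0 => _ [t' _ <-]; have /andP[] := emp_risk01 xi n_gt0 gamma01 om t'.
move: dev_t; rewrite /deviation /centered_emp_risk.
have := ellE P s gamma01 mgamma t; have := ellE P s gamma01 mgamma u.
lra.
Qed.

End Localization.

Lemma max_ord_widen (R : realType) (N M : nat) (F : nat -> R) : (N <= M)%N ->
  max_ord (fun j : 'I_N.+1 => F j) <= max_ord (fun j : 'I_M.+1 => F j).
Proof.
move=> NM; rewrite {1}/max_ord; set j := argmax_ord _.
exact: (argmax_ordP (fun j : 'I_M.+1 => F j) (widen_ord (NM : (N.+1 <= M.+1)%N) j)).
Qed.

Theorem theorem2 (R : realType) :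
  exists kappa : R,
  forall (dO dZ dS : measure_display)
    (Omega : measurableType dO) (Z : measurableType dZ)
    (SS : measurableType dS)
    (Pr : probability Omega R) (P : probability Z R)
    (n : nat) (xi : 'I_n -> {RV Pr >-> Z})
    (gamma : SS -> Z -> R) (s : SS) (d : SS -> SS -> R)
    (phi w : R -> R) (S S' : set SS)
    (eps rho : R) (shat : Omega -> SS),
    (0 < n)%N ->
    iid P xi ->
    (forall t z, 0 <= gamma t z <= 1) ->
    (forall t, measurable_fun [set: Z] (gamma t)) ->
    measurable_fun [set: SS] (ell P gamma s) ->
    (forall t, risk P gamma s <= risk P gamma t) ->
    pseudo_distance d ->
    (forall t, ('V_P[fun z => (gamma t z - gamma s z)%R] <= (d s t ^+ 2)%:E)%E) ->
    classC1 phi -> classC1 w ->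
    separability gamma S S' ->
    (forall t, d s t <= w (Num.sqrt (ell P gamma s t))) ->
    (forall u, S' u -> forall sigma : R, 0 < sigma ->
      phi sigma <= Num.sqrt n%:R * sigma ^+ 2 ->
      ((Num.sqrt n%:R)%:E *
       'E_Pr[fun omega =>
         (sup [set centered_emp_risk P gamma (sample xi omega) u
                   - centered_emp_risk P gamma (sample xi omega) t
              | t in [set t | S' t /\ d u t <= sigma]])%R]
       <= (phi sigma)%:E)%E) ->
    0 < eps -> Num.sqrt n%:R * eps ^+ 2 = phi (w eps) ->
    0 <= rho ->
    empirical_risk_minimizer xi gamma S rho shat ->
    (forall y : R, 1 <= y ->
      (Pr [set omega | (ell P gamma s (shat omega) >
             2 * rho + 2 * ell_set P gamma s S + kappa * y * eps ^+ 2)%R]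
       <= (expR (- y))%:E)%E) /\
    ('E_Pr[fun omega => ell P gamma s (shat omega)] <=
       (2 * (rho + ell_set P gamma s S + kappa * eps ^+ 2))%:E)%E.
Proof.
(* [3 (c eps)^2] for the localization level [c^2 = 2^18 y]. *)
exists (3 * 2 ^+ 18).
move=> dO dZ dS Omega Z SS Pr P n xi gamma s d phi w S S' eps rho shat.
move=> n_gt0 xi_iid gamma01 mgamma mell s_min d_pseudo d_var phiC1 wC1 S_sep d_w
  sup_phi eps_gt0 eps_eq rho_ge0 [[h mh shatE] S_shat shat_min].
have [S'_countable S'S _] := S_sep.
have S0 : S !=set0 by exists (shat point).
have inf0 : 0 <= ell_set P gamma s S.
  apply: lb_le_inf; first by case: S0 => t St; exists (ell P gamma s t), t.
  by move=> _ [t _ <-]; exact: ell_ge0.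
have m_ell_shat : measurable_fun [set: Omega] (fun om => ell P gamma s (shat om)).
  rewrite shatE; apply: (measurableT_comp mell).
  apply: (measurableT_comp mh); apply/measurable_fun_tnthP => i.
  rewrite (_ : _ \o _ = xi i); first exact: measurable_funP.
  by apply/funext => om /=; rewrite tnth_mktuple.
have tail (y : R) : 1 <= y ->
    (Pr [set om | (ell P gamma s (shat om) >
       2 * rho + 2 * ell_set P gamma s S + 3 * 2 ^+ 18 * y * eps ^+ 2)%R]
     <= (expR (- y))%:E)%E.
  move=> y1.
  have [eps_le1|eps_gt1] := leP eps 1; last first.
    rewrite (_ : [set om | _] = set0) ?measure0 ?lee_fin ?expR_ge0//.
    apply/seteqP; split => // om /=; apply/negP; rewrite -leNgt.
    apply: (le_trans (ell_le1 _ _ gamma01 mgamma _)).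
    have h1 : 1 <= 3 * 2 ^+ 18 * y * eps ^+ 2.
      rewrite !mulr_ege1 ?exprn_ege1 ?ler1n// ltW//.
    lra.
  pose c := Num.sqrt (2 ^+ 18 * y).
  have cy : c ^+ 2 = 2 ^+ 18 * y.
    by rewrite sqr_sqrtr// mulr_ge0 ?exprn_ge0// (le_trans _ y1).
  have c_ge1 : 1 <= c.
    by rewrite -(@sqrtr1 R) ler_wsqrtr// mulr_ege1// exprn_ege1// ler1n.
  have x2_gt0 : 0 < (c * eps) ^+ 2.
    by rewrite exprn_gt0// mulr_gt0// (lt_le_trans _ c_ge1).
  have [u S'u u_near] := near_minimizer gamma01 mgamma s_min S_sep S0 x2_gt0.
  have u_near_best t : S' t -> ell P gamma s u <= ell P gamma s t + (c * eps) ^+ 2.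
    move=> /S'S St; apply: (le_trans u_near); rewrite lerD2r.
    exact: inf_ell_le.
  (* The events for the first [N.+1] points of this enumeration increase with [N], so the uniform
     finite bound passes to their union, which contains the bad event. *)
  have [e S'e] : exists e : nat -> SS, S' = range e.
    by apply: countable_range => //; exists u.
  pose ratio t om := deviation P xi gamma u t om / (ell P gamma s t + (c * eps) ^+ 2).
  pose F N := [set om | max_ord (fun j : 'I_N.+1 => ratio (e j) om) > 2^-1].
  have mF N : measurable (F N).
    apply: measurable_gt; apply: (bdmeas_max_ord _).1 => j.
    have := bdmeasZ (ell P gamma s (e j) + (c * eps) ^+ 2)^-1
      (bdmeas_deviation P xi gamma01 mgamma u (e j)).
    by congr bdmeas; apply/funext => om; rewrite mulrC.
  have ndF : nondecreasing_seq F.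
    move=> N M NM; apply/subsetPset => om /= hN; apply: (lt_le_trans hN).
    exact: (max_ord_widen (fun k => ratio (e k) om) NM).
  have Fq N : fine (Pr (F N)) <= expR (- y).
    apply: (finite_deviation_tail n_gt0 xi_iid gamma01 mgamma s_min d_pseudo d_var
      phiC1 wC1 S'_countable d_w sup_phi eps_gt0 eps_le1 eps_eq S'u c_ge1
      u_near_best _ y1 cy) => j.
    by rewrite S'e; exists j.
  apply: le_trans (prob_bigcup_le mF ndF Fq).
  apply: le_measure.
  - by rewrite inE; exact: measurable_gt.
  - by rewrite inE; exact: bigcupT_measurable.
  move=> om /= bad; apply: contrapT => good; move: bad; apply/negP; rewrite -leNgt.
  have := minimizer_ell_le gamma01 mgamma S_sep n_gt0 (ltW x2_gt0) (S_shat om)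
    (S'S _ S'u) u_near (shat_min om).
  rewrite exprMn cy => /(_ _)/wrap[].
    move=> t; rewrite S'e => -[k _ <-].
    rewrite leNgt; apply/negP => dk; apply: good; exists k => //=.
    apply: lt_le_trans (argmax_ordP (fun j : 'I_k.+1 => ratio (e j) om) ord_max).
    rewrite /ratio/= exprMn cy ltr_pdivlMr; first by rewrite mulrC.
    by rewrite -cy -exprMn ltr_wpDl//; exact: ell_ge0.
  by move=> /le_trans; apply; rewrite lerD2l -!mulrA.
split; first exact: tail.
have b_ell : bdmeas (fun om => ell P gamma s (shat om)).
  split => //; exists 1 => om.
  by rewrite ger0_norm ?ell_le1// ell_ge0.
rewrite bdmeas_mean// lee_fin.
rewrite (_ : 2 * _ = 2 * rho + 2 * ell_set P gamma s S + 2 * (3 * 2 ^+ 18 * eps ^+ 2)); last by ring.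
apply: mean_le_of_tail => //; first by rewrite !mulr_gt0 ?exprn_gt0.
by move=> y y1; rewrite mulrCA mulrA; exact: tail.
Qed.
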